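(* Let $f(z)=z+\sum_{n\ge 2}a_nz^n$ belong to the class $C$ of normalized convex univalent functions, with $a_2=0$. If $f$ is not a rotation of the parallel strip function $s_0(z)=\frac12\log\frac{1+z}{1-z}$, then $f(e^{i\theta})\in\Lambda_t$ for $t=\frac{1-3|a_3|}{3(1+|a_3|)}$.
   Context: $\mathbb{D}$ is the open unit disk. $S$ is the class of univalent (injective holomorphic) functions $f(z)=z+\sum_{n=2}^\infty a_nz^n$ in $\mathbb{D}$. $C\subset S$ consists of those $f\in S$ whose range $f(\mathbb{D})$ is a convex set. A rotation of a function $g$ is a function $z\mapsto\overline{\lambda}g(\lambda z)$ with $|\lambda|=1$. $f(e^{i\theta})$ denotes the boundary function of $f$ (the assertion $f(e^{i\theta})\in\Lambda_t$ includes that $f$ extends continuously to $\overline{\mathbb{D}}$). For $t\in(0,1]$, $\Lambda_t$ is the class of functions $\phi$ on $[0,2\pi]$ for which there is $c>0$ with $|\phi(x)-\phi(y)|\le c|x-y|^t$ for all $x,y$. *)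

(* Defs.v *)
(* Stdlib reals with Coquelicot's complex numbers. *)
From Stdlib Require Import Reals.
From Coquelicot Require Import Coquelicot.
Open Scope R_scope.

Definition unit_disk (z : C) : Prop := Cmod z < 1.

Definition closed_unit_disk (z : C) : Prop := Cmod z <= 1.

(* Complex differentiability: the scalar field of the derivative is C. *)
Definition holomorphic_on (D : C -> Prop) (f : C -> C) : Prop :=
  forall z : C, D z -> ex_derive (K := C_AbsRing) (V := C_NormedModule) f z.

Definition injective_on (D : C -> Prop) (f : C -> C) : Prop :=
  forall z w : C, D z -> D w -> f z = f w -> z = w.

Definition image_of (D : C -> Prop) (f : C -> C) (w : C) : Prop :=
  exists z : C, D z /\ f z = w.

Definition convex_set (A : C -> Prop) : Prop :=
  forall (u v : C) (s : R), A u -> A v -> 0 <= s <= 1 ->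
    A ((1 - s)%R * u + s * v)%C.

(* The class S.  A function on the disk is a total map C -> C of which only the
   values on the disk matter; [a] is its sequence of Taylor coefficients at 0,
   uniquely determined by [f]. *)
Definition class_S (f : C -> C) (a : nat -> C) : Prop :=
  holomorphic_on unit_disk f /\
  injective_on unit_disk f /\
  (forall z : C, unit_disk z ->
     is_pseries (K := C_AbsRing) (V := C_NormedModule) a z (f z)) /\
  a 0%nat = 0%C /\
  a 1%nat = 1%C.

Definition class_C (f : C -> C) (a : nat -> C) : Prop :=
  class_S f a /\ convex_set (image_of unit_disk f).

(* Principal argument, in (-PI, PI]; the value at 0 is irrelevant. *)
Definition Carg (w : C) : R :=
  if Rle_dec 0 (Im w) then acos (Re w / Cmod w) else - acos (Re w / Cmod w).

Definition Clog (w : C) : C := (ln (Cmod w), Carg w).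

(* The quotient (1 + z) / (1 - z) lies in the right half-plane for z in the
   disk, so the principal branch is the one vanishing at z = 0. *)
Definition parallel_strip (z : C) : C :=
  ((1 / 2)%R * Clog ((1 + z) / (1 - z)))%C.

(* [f] agrees on the disk with some rotation of [g]. *)
Definition is_rotation_of (g f : C -> C) : Prop :=
  exists lambda : C, Cmod lambda = 1 /\
    forall z : C, unit_disk z -> f z = (Cconj lambda * g (lambda * z))%C.

Definition cis (theta : R) : C := (cos theta, sin theta).

(* Membership includes the standing requirement 0 < t <= 1.  [Rpower 0 t] is 1
   in the library rather than 0; this is harmless, because for x = y the
   left-hand side vanishes and the inequality holds with either value. *)
Definition Lambda (t : R) (phi : R -> C) : Prop :=
  0 < t <= 1 /\
  exists c : R, 0 < c /\
    forall x y : R, 0 <= x <= 2 * PI -> 0 <= y <= 2 * PI ->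
      Cmod (phi x - phi y)%C <= c * Rpower (Rabs (x - y)) t.

(* [f] has a (necessarily unique) continuous extension [F] to the closed disk,
   and its boundary function theta |-> F (e^(i theta)) is of class Lambda t. *)
Definition boundary_in_Lambda (f : C -> C) (t : R) : Prop :=
  exists F : C -> C,
    continuous_on closed_unit_disk F /\
    (forall z : C, unit_disk z -> F z = f z) /\
    Lambda t (fun theta : R => F (cis theta)).

(* Main.v *)
Require Import Defs.
From Stdlib Require Import Reals Lra Lia Psatz ClassicalEpsilon FunctionalExtensionality.
From Coquelicot Require Import Coquelicot.
Open Scope R_scope.

(** For a convex univalent [f] the function [p = 1 + z f'' / f'] has
    nonnegative real part: if [lambda] is a rotation close to the identity, the
    average of [f (lambda z)] and [f (conj lambda * z)] lies in the convex range,
    hence equals [f (w z)] for a self-map [w] of the disk fixing 0; Schwarz'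
    lemma gives [|w z| <= |z|], and a second-order expansion as [lambda] tends
    to 1 turns this into [Re p >= 0] ([rotation_average], [convex_real_part]).

    Consequently [(p - 1) / (p + 1)] is bounded by 1.  It vanishes to second
    order at 0 because [a_2 = 0], so it is [z^2 psi] with [|psi| <= 1] and
    [psi 0 = 3 a_3] ([convex_schwarz_function]); solving for [f''],
    [f'' / f' = 2 z psi / (1 - z^2 psi)].  Put [al = |psi 0| = 3 |a_3|].

    If [al = 1], the Schwarz-Pick inequality makes [psi] a constant [lambda^2] of
    modulus one, so [f' = 1 / (1 - lambda^2 z^2)] and [f] is a rotation of the
    strip map ([derivative_of_extremal], [strip_of_derivative]).

    If [al < 1], Schwarz-Pick gives [|psi z| <= (r + al) / (1 + al r)] with
    [r = |z|], and a computation ([pre_schwarzian_rate]) yields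
    [|f'' / f'| <= (1 - t) / (1 - r)] where [1 - t = 2 (1 + al) / (3 + al)],
    that is, [t = (1 - al) / (3 + al)] is the exponent of the theorem.
    Integrating along radii gives [|f'| <= (1 - r)^(t - 1)]
    ([growth_of_log_derivative]), and the Hardy-Littlewood argument turns this
    into a Holder condition of order [t] on the disk, which passes to the
    closed disk ([hardy_littlewood], [holder_extension]).

    The complex analysis rests on two elementary devices.  Power series stay
    centred at 0 and are divided by [z - z0] ([psum_quotient]), which replaces
    re-expansion at other points.  The maximum principle is proved for functions
    with second-order Taylor expansions by averaging over four points
    ([no_interior_max]), without contour integrals; such expansions are
    inherited by quotients, compositions and inverses, so the principle applies
    to [f^-1] composed with an average of rotates of [f]. *)

(** * Complex power series on the unit disk *)

(** Convergence is expressed through the real sequence of distances, so that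
    squeezing and linearity of real limits can be used. *)
Definition clim (u : nat -> C) (l : C) : Prop :=
  is_lim_seq (fun n => Cmod (u n - l)%C) 0.

Lemma is_lim_seq_squeeze_0 (u v : nat -> R) :
  (forall n, 0 <= u n <= v n) -> is_lim_seq v 0 -> is_lim_seq u 0.
Proof.
  intros H Hv. apply (is_lim_seq_le_le (fun _ => 0) u v); auto.
  apply is_lim_seq_const.
Qed.

Lemma clim_ext (u v : nat -> C) l : (forall n, u n = v n) -> clim u l -> clim v l.
Proof.
  intros H Hu. apply is_lim_seq_ext with (2 := Hu). intros n. now rewrite H.
Qed.

Lemma clim_plus (u v : nat -> C) l m :
  clim u l -> clim v m -> clim (fun n => u n + v n)%C (l + m)%C.
Proof.
  intros Hu Hv. unfold clim in *.
  apply is_lim_seq_squeeze_0 with (fun n => Cmod (u n - l)%C + Cmod (v n - m)%C).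
  - intros n. split. apply Cmod_ge_0.
    replace (u n + v n - (l + m))%C with ((u n - l) + (v n - m))%C by ring.
    apply Cmod_triangle.
  - replace 0 with (0 + 0) by ring. now apply is_lim_seq_plus'.
Qed.

Lemma clim_const l : clim (fun _ => l) l.
Proof.
  unfold clim. apply is_lim_seq_ext with (fun _ => 0).
  intros _. replace (l - l)%C with (RtoC 0) by ring. now rewrite Cmod_0.
  apply is_lim_seq_const.
Qed.

Lemma clim_scal c (u : nat -> C) l : clim u l -> clim (fun n => c * u n)%C (c * l)%C.
Proof.
  intros Hu. unfold clim in *.
  apply is_lim_seq_ext with (fun n => Cmod c * Cmod (u n - l)%C).
  - intros n. rewrite <- Cmod_mult. f_equal. ring.
  - replace (Finite 0) with (Rbar_mult (Cmod c) 0) by (simpl; f_equal; ring).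
    apply is_lim_seq_scal_l, Hu.
Qed.

Lemma clim_minus (u v : nat -> C) l m :
  clim u l -> clim v m -> clim (fun n => u n - v n)%C (l - m)%C.
Proof.
  intros Hu Hv. apply clim_ext with (fun n => u n + (-(1)) * v n)%C.
  intros n; ring.
  replace (l - m)%C with (l + (-(1)) * m)%C by ring.
  apply clim_plus; auto. now apply clim_scal.
Qed.

Lemma clim_unique (u : nat -> C) l m : clim u l -> clim u m -> l = m.
Proof.
  intros Hl Hm.
  assert (H := clim_minus _ _ _ _ Hl Hm).
  assert (E : Cmod (l - m)%C = 0).
  { assert (is_lim_seq (fun _ : nat => Cmod (l - m)%C) 0).
    { apply is_lim_seq_ext with (2 := H). intros n.
      replace (u n - u n - (l - m))%C with (- (l - m))%C by ring.
      apply Cmod_opp. }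
    assert (H1 := is_lim_seq_unique _ _ H0).
    rewrite Lim_seq_const in H1. now injection H1. }
  apply Cmod_eq_0 in E.
  replace l with ((l - m) + m)%C by ring. rewrite E. ring.
Qed.

Lemma clim_incr_1 (u : nat -> C) l : clim (fun n => u (S n)) l <-> clim u l.
Proof. unfold clim. symmetry. apply (is_lim_seq_incr_1 (fun n => Cmod (u n - l)%C)). Qed.

Lemma clim_bound (u : nat -> C) l M :
  (forall n, Cmod (u n) <= M) -> clim u l -> Cmod l <= M.
Proof.
  intros Hb Hl.
  assert (is_lim_seq (fun n => Cmod (u n - l)%C + M) (0 + M)).
  { apply is_lim_seq_plus'. exact Hl. apply is_lim_seq_const. }
  replace M with (0 + M) by ring.
  apply (is_lim_seq_le (fun _ => Cmod l) _ (Cmod l) (0 + M)) with (3 := H).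
  - intros n. specialize (Hb n).
    replace l with (u n - (u n - l))%C at 1 by ring.
    eapply Rle_trans. apply Cmod_triangle. rewrite Cmod_opp. lra.
  - apply is_lim_seq_const.
Qed.

Fixpoint csum (a : nat -> C) (z : C) (n : nat) : C :=
  match n with
  | O => 0
  | S k => (csum a z k + a k * z ^ k)%C
  end.

(** The coordinatewise limit is defined for every [z], so sums need no
    convergence proof as an argument. *)
Definition psum (a : nat -> C) (z : C) : C :=
  (real (Lim_seq (fun n => Re (csum a z n))), real (Lim_seq (fun n => Im (csum a z n)))).

(** Equivalent to a radius of convergence of at least 1; stated as a growth
    condition because this is what shifts and difference quotients preserve. *)
Definition summable (a : nat -> C) : Prop :=
  forall rho, 0 < rho < 1 -> exists M, forall n, Cmod (a n) * rho ^ n <= M.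

Lemma csum_bound (a : nat -> C) z M q n :
  0 <= q < 1 -> 0 <= M -> (forall k, Cmod (a k) * Cmod z ^ k <= M * q ^ k) ->
  Cmod (csum a z n) <= M / (1 - q).
Proof.
  intros Hq HM Ha.
  apply Rle_trans with (M * (1 - q ^ n) / (1 - q)).
  - induction n; simpl.
    + rewrite Cmod_0. right. field. lra.
    + eapply Rle_trans. apply Cmod_triangle. rewrite Cmod_mult, Cmod_pow.
      specialize (Ha n).
      replace (M * (1 - q * q ^ n) / (1 - q)) with (M * (1 - q ^ n) / (1 - q) + M * q ^ n)
        by (field; lra). lra.
  - apply Rmult_le_compat_r. left. apply Rinv_0_lt_compat; lra.
    assert (0 <= q ^ n) by (apply pow_le; lra). nra.
Qed.

Lemma re_csum a z n : Re (csum a z (S n)) = sum_n (fun k => Re (a k * z ^ k)%C) n.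
Proof.
  induction n. rewrite sum_O. simpl. ring.
  rewrite sum_Sn, <- IHn. reflexivity.
Qed.

Lemma im_csum a z n : Im (csum a z (S n)) = sum_n (fun k => Im (a k * z ^ k)%C) n.
Proof.
  induction n. rewrite sum_O. simpl. ring.
  rewrite sum_Sn, <- IHn. reflexivity.
Qed.

Lemma im_le_Cmod (c : C) : Rabs (Im c) <= Cmod c.
Proof.
  eapply Rle_trans. 2: apply Rmax_Cmod. apply Rmax_r.
Qed.

Lemma Cmod_le_re_im (c : C) : Cmod c <= Rabs (Re c) + Rabs (Im c).
Proof.
  replace c with (RtoC (Re c) + Ci * RtoC (Im c))%C at 1.
  eapply Rle_trans. apply Cmod_triangle.
  rewrite Cmod_mult, !Cmod_R, Cmod_Ci. lra.
  destruct c. unfold Ci, RtoC, Cplus, Cmult. simpl. f_equal; ring.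
Qed.

(** Applying the growth condition at a radius between [|z|] and 1 leaves a
    geometric series as majorant. *)
Lemma summable_dom a z :
  summable a -> Cmod z < 1 ->
  exists M q, 0 <= q < 1 /\ 0 <= M /\ forall k, Cmod (a k) * Cmod z ^ k <= M * q ^ k.
Proof.
  intros Ha Hz. assert (H0 := Cmod_ge_0 z).
  set (rho := (1 + Cmod z) / 2).
  destruct (Ha rho) as [M HM]. unfold rho; lra.
  exists M, (Cmod z / rho).
  assert (Hr : 0 < rho) by (unfold rho; lra).
  split; [|split].
  - split. apply Rmult_le_pos. lra. left. now apply Rinv_0_lt_compat.
    apply (Rmult_lt_reg_r rho); auto. unfold Rdiv. rewrite Rmult_assoc, Rinv_l by lra.
    unfold rho; lra.
  - apply Rle_trans with (2 := HM 0%nat). simpl. assert (H := Cmod_ge_0 (a 0%nat)). lra.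
  - intros k. unfold Rdiv. rewrite Rpow_mult_distr, pow_inv.
    assert (0 < rho ^ k) by now apply pow_lt.
    apply Rle_trans with ((Cmod (a k) * rho ^ k) * (Cmod z ^ k * / rho ^ k)).
    + right. field. lra.
    + apply Rmult_le_compat_r; auto. apply Rmult_le_pos. apply pow_le; lra.
      left. now apply Rinv_0_lt_compat.
Qed.

Lemma psum_clim a z : summable a -> Cmod z < 1 -> clim (csum a z) (psum a z).
Proof.
  intros Ha Hz. destruct (summable_dom a z Ha Hz) as (M & q & Hq & HM & Hd).
  assert (Hg : ex_series (fun k => M * q ^ k)).
  { apply (ex_series_scal_l (K := R_AbsRing) (V := R_NormedModule) M (fun k => q ^ k)). apply ex_series_geom. rewrite Rabs_pos_eq; lra. }
  assert (A : forall p : C -> R, (forall c, Rabs (p c) <= Cmod c) ->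
     (forall n, p (csum a z (S n)) = sum_n (fun k => p (a k * z ^ k)%C) n) ->
     is_lim_seq (fun n => p (csum a z n)) (real (Lim_seq (fun n => p (csum a z n))))).
  { intros p Hp Hs.
    assert (E : ex_series (fun k => p (a k * z ^ k)%C)).
    { apply (ex_series_le (K := R_AbsRing) (V := R_CompleteNormedModule)) with (2 := Hg).
      intros n. eapply Rle_trans. apply Hp. rewrite Cmod_mult, Cmod_pow. apply Hd. }
    destruct E as [l El].
    assert (L : is_lim_seq (fun n => p (csum a z n)) l).
    { apply is_lim_seq_incr_1. apply is_lim_seq_ext with (2 := El).
      intros n. symmetry. apply Hs. }
    rewrite (is_lim_seq_unique _ _ L). exact L. }
  assert (Lr := A Re (re_le_Cmod) (re_csum a z)).
  assert (Li := A Im (im_le_Cmod) (im_csum a z)).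
  unfold clim.
  apply is_lim_seq_squeeze_0 with
   (fun n => Rabs (Re (csum a z n) - Re (psum a z)) + Rabs (Im (csum a z n) - Im (psum a z))).
  - intros n. split. apply Cmod_ge_0. apply Cmod_le_re_im.
  - replace (Finite 0) with (Finite (Rabs (Re (psum a z) - Re (psum a z)) + Rabs (Im (psum a z) - Im (psum a z)))).
    2: { f_equal. rewrite !Rminus_diag, Rabs_R0. ring. }
    apply is_lim_seq_plus';
     apply (is_lim_seq_abs _ (Finite _)); apply is_lim_seq_minus'; auto; apply is_lim_seq_const.
Qed.

Lemma psum_bound a z M q :
  summable a -> Cmod z < 1 ->
  0 <= q < 1 -> 0 <= M -> (forall k, Cmod (a k) * Cmod z ^ k <= M * q ^ k) ->
  Cmod (psum a z) <= M / (1 - q).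
Proof.
  intros Ha Hz Hq HM Hd. apply clim_bound with (csum a z).
  - intros n. now apply csum_bound.
  - now apply psum_clim.
Qed.

Lemma psum_unique a z l : summable a -> Cmod z < 1 -> clim (csum a z) l -> psum a z = l.
Proof.
  intros Ha Hz Hl. apply clim_unique with (csum a z); auto. now apply psum_clim.
Qed.

Lemma psum_locally_bounded a rho :
  summable a -> rho < 1 -> exists M, 0 < M /\ forall z, Cmod z <= rho -> Cmod (psum a z) <= M.
Proof.
  intros Ha Hr.
  destruct (Rlt_dec rho 0) as [Hn|Hp].
  { exists 1. split. lra. intros z Hz. assert (H := Cmod_ge_0 z). lra. }
  destruct (summable_dom a (RtoC rho) Ha) as (M & q & Hq & HM & Hd).
  { rewrite Cmod_R, Rabs_pos_eq; lra. }
  exists (M / (1 - q) + 1). split.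
  { assert (0 <= M / (1 - q)). apply Rmult_le_pos; auto. left; apply Rinv_0_lt_compat; lra. lra. }
  intros z Hz. apply Rle_trans with (M / (1 - q)). 2: lra.
  apply psum_bound; auto. lra.
  intros k. eapply Rle_trans. 2: apply Hd.
  apply Rmult_le_compat_l. apply Cmod_ge_0. apply pow_incr. split. apply Cmod_ge_0.
  rewrite Cmod_R, Rabs_pos_eq; lra.
Qed.

(** Terms of a convergent series are bounded, and this at every radius below 1. *)
Lemma clim_summable a (F : C -> C) :
  (forall z, Cmod z < 1 -> clim (csum a z) (F z)) -> summable a.
Proof.
  intros H rho Hrho.
  assert (Hz : Cmod (RtoC rho) < 1) by (rewrite Cmod_R, Rabs_pos_eq; lra).
  assert (L := H _ Hz).
  assert (L2 : clim (fun n => csum a rho (S n) - csum a rho n)%C (F rho - F rho)%C).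
  { apply clim_minus; auto. now apply clim_incr_1. }
  assert (L3 : ex_finite_lim_seq (fun n => Cmod (a n) * rho ^ n)).
  { exists 0. apply is_lim_seq_ext with (2 := L2). intros n. simpl.
    replace (csum a rho n + a n * rho ^ n - csum a rho n - (F rho - F rho))%C
       with (a n * rho ^ n)%C by ring.
    rewrite Cmod_mult, Cmod_pow, Cmod_R, Rabs_pos_eq; lra. }
  destruct L3 as [l L3].
  apply is_lim_seq_spec in L3. destruct (L3 (mkposreal 1 Rlt_0_1)) as [N HN]. simpl in HN.
  assert (B : exists M, forall n, (n < N)%nat -> Cmod (a n) * rho ^ n <= M).
  { clear. induction N. exists 0; intros; lia.
    destruct IHN as [M HM]. exists (Rmax M (Cmod (a N) * rho ^ N)).
    intros n Hn. destruct (Nat.eq_dec n N). subst. apply Rmax_r.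
    eapply Rle_trans. apply HM. lia. apply Rmax_l. }
  destruct B as [M HM]. exists (Rmax M (l + 1)). intros n.
  destruct (Nat.lt_ge_cases n N).
  eapply Rle_trans. now apply HM. apply Rmax_l.
  eapply Rle_trans. 2: apply Rmax_r. specialize (HN n H0). apply Rabs_def2 in HN. lra.
Qed.

(** This is Bernoulli's inequality for the powers of [1 / r]. *)
Lemma nat_pow_bound r n : 0 < r < 1 -> INR n * r ^ n <= r / (1 - r).
Proof.
  intros Hr. set (h := / r - 1).
  assert (Hh : 0 < h). { unfold h. assert (1 < / r). rewrite <- Rinv_1. apply Rinv_lt_contravar; lra. lra. }
  assert (B := poly n h Hh).
  assert (E : (1 + h) ^ n * r ^ n = 1).
  { rewrite <- Rpow_mult_distr. unfold h. replace ((1 + (/ r - 1)) * r) with 1 by (field; lra).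
    apply pow1. }
  assert (0 < r ^ n) by (apply pow_lt; lra).
  assert (INR n * h * r ^ n <= 1) by nra.
  replace (r / (1 - r)) with (1 / h) by (unfold h; field; lra).
  apply (Rmult_le_reg_r h); auto. unfold Rdiv. rewrite Rmult_1_l, Rinv_l; lra.
Qed.

(** The terms decay geometrically, which beats the factor [n] produced by
    summation by parts. *)
Lemma summable_term_lim a z :
  summable a -> Cmod z < 1 -> is_lim_seq (fun n => INR n * (Cmod (a n) * Cmod z ^ n)) 0.
Proof.
  intros Ha Hz. assert (H0 := Cmod_ge_0 z).
  destruct (summable_dom a z Ha Hz) as (M & q & Hq & HM & Hd).
  (* in [q = r * (q / r)] one factor absorbs [n] and the other one still decays *)
  set (r := (1 + q) / 2). assert (Hr : 0 < r < 1) by (unfold r; lra).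
  set (s := q / r).
  assert (Hs : 0 <= s < 1).
  { unfold s. split. apply Rmult_le_pos. lra. left. apply Rinv_0_lt_compat; lra.
    apply (Rmult_lt_reg_r r). lra. unfold Rdiv. rewrite Rmult_assoc, Rinv_l by lra. unfold r; lra. }
  apply is_lim_seq_squeeze_0 with (fun n => (M * (r / (1 - r))) * s ^ n).
  - intros n. assert (0 <= INR n) by apply pos_INR. split.
    + apply Rmult_le_pos; auto. apply Rmult_le_pos. apply Cmod_ge_0. now apply pow_le.
    + apply Rle_trans with (INR n * (M * q ^ n)). apply Rmult_le_compat_l; auto.
      replace q with (r * s) by (unfold s; field; lra). rewrite Rpow_mult_distr.
      assert (B := nat_pow_bound r n Hr). assert (0 <= s ^ n) by (apply pow_le; lra).
      replace (INR n * (M * (r ^ n * s ^ n))) with ((INR n * r ^ n) * (M * s ^ n)) by ring.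
      replace (M * (r / (1 - r)) * s ^ n) with ((r / (1 - r)) * (M * s ^ n)) by ring.
      apply Rmult_le_compat_r; auto. now apply Rmult_le_pos.
  - replace (Finite 0) with (Rbar_mult (M * (r / (1 - r))) 0) by (simpl; f_equal; ring).
    apply is_lim_seq_scal_l. apply is_lim_seq_geom. rewrite Rabs_pos_eq; lra.
Qed.

(** * Difference quotients and derivatives of power series *)

Definition shift (k : nat) (a : nat -> C) (n : nat) : C := a (k + n)%nat.

(** Coefficients of the difference quotient [(psum a z - psum a z0) / (z - z0)]
    as a power series in [z] that is again centred at 0: expanding
    [(z^n - z0^n) / (z - z0)] shows that [z^j] comes with the sum of the
    [a_(j+1+m) z0^m]. *)
Definition quotient (z0 : C) (a : nat -> C) (j : nat) : C := psum (shift (S j) a) z0.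

Definition derived (a : nat -> C) (n : nat) : C := (INR (S n) * a (S n))%C.

Lemma shift_summable k a : summable a -> summable (shift k a).
Proof.
  intros Ha rho Hr. destruct (Ha rho Hr) as [M HM].
  assert (0 < rho ^ k) by (apply pow_lt; lra).
  exists (M / rho ^ k). intros n. unfold shift.
  apply (Rmult_le_reg_r (rho ^ k)); auto.
  replace (M / rho ^ k * rho ^ k) with M by (field; lra).
  specialize (HM (k + n)%nat). rewrite pow_add in HM. lra.
Qed.

Lemma csum_shift a z n : csum a z (S n) = (a 0%nat + z * csum (shift 1 a) z n)%C.
Proof.
  induction n. simpl. ring.
  change (csum a z (S (S n))) with (csum a z (S n) + a (S n) * z ^ (S n))%C.
  rewrite IHn. simpl. unfold shift. simpl. ring.
Qed.

Lemma psum_shift a z :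
  summable a -> Cmod z < 1 -> psum a z = (a 0%nat + z * psum (shift 1 a) z)%C.
Proof.
  intros Ha Hz. apply psum_unique; auto. apply clim_incr_1.
  apply clim_ext with (fun n => a 0%nat + z * csum (shift 1 a) z n)%C.
  intros; now rewrite csum_shift.
  apply clim_plus. apply clim_const. apply clim_scal. apply psum_clim; auto.
  now apply shift_summable.
Qed.

Lemma psum_0 a : summable a -> psum a 0 = a 0%nat.
Proof. intros Ha. rewrite psum_shift; auto. ring. rewrite Cmod_0; lra. Qed.

Lemma quotient_rec z0 a j :
  summable a -> Cmod z0 < 1 -> quotient z0 a j = (a (S j) + z0 * quotient z0 a (S j))%C.
Proof.
  intros Ha Hz. unfold quotient at 1. rewrite psum_shift; auto.
  2: now apply shift_summable.
  unfold shift at 1. rewrite Nat.add_0_r.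
  replace (shift 1 (shift (S j) a)) with (shift (S (S j)) a); [reflexivity|].
  extensionality n. unfold shift. f_equal. lia.
Qed.

(** The shifted sequence is [r^-(j+1)] times one whose sum at [z0] is bounded
    independently of [j], for any [r] between [|z0|] and 1. *)
Lemma quotient_summable z0 a : summable a -> Cmod z0 < 1 -> summable (quotient z0 a).
Proof.
  intros Ha Hz rho Hr. assert (H0 := Cmod_ge_0 z0).
  set (r := Rmax rho ((1 + Cmod z0) / 2)).
  assert (Hr1 : rho <= r) by apply Rmax_l.
  assert (Hr2 : Cmod z0 < r) by (apply Rlt_le_trans with (2 := Rmax_r _ _); lra).
  assert (Hr3 : r < 1) by (apply Rmax_lub_lt; lra).
  destruct (Ha r) as [M HM]. lra.
  assert (HM0 : 0 <= M).
  { apply Rle_trans with (2 := HM 0%nat). simpl. assert (H := Cmod_ge_0 (a 0%nat)). lra. }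
  set (q := Cmod z0 / r).
  assert (Hq : 0 <= q < 1).
  { unfold q. split. apply Rmult_le_pos. lra. left. apply Rinv_0_lt_compat; lra.
    apply (Rmult_lt_reg_r r). lra. unfold Rdiv. rewrite Rmult_assoc, Rinv_l by lra. lra. }
  exists (M / r / (1 - q)). intros j.
  assert (Hj : 0 < r ^ (S j)) by (apply pow_lt; lra).
  assert (Hb : Cmod (quotient z0 a j) <= (M / r ^ (S j)) / (1 - q)).
  { apply psum_bound; auto. now apply shift_summable.
    apply Rmult_le_pos; auto. left. now apply Rinv_0_lt_compat.
    intros k. unfold shift.
    assert (0 < r ^ k) by (apply pow_lt; lra).
    replace (M / r ^ S j * q ^ k) with (M * (Cmod z0 ^ k / (r ^ S j * r ^ k))).
    2: { unfold q, Rdiv. rewrite Rpow_mult_distr, pow_inv. field. split; lra. }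
    specialize (HM (S j + k)%nat). rewrite pow_add in HM.
    replace (Cmod (a (S j + k)%nat) * Cmod z0 ^ k) with
      ((Cmod (a (S j + k)%nat) * (r ^ S j * r ^ k)) * (Cmod z0 ^ k / (r ^ S j * r ^ k))).
    2: field; split; lra.
    apply Rmult_le_compat_r; auto. apply Rmult_le_pos. now apply pow_le.
    left. apply Rinv_0_lt_compat. now apply Rmult_lt_0_compat. }
  apply Rle_trans with ((M / r ^ (S j)) / (1 - q) * r ^ j).
  - apply Rmult_le_compat; auto. apply Cmod_ge_0. apply pow_le; lra.
    apply pow_incr; lra.
  - right. simpl. field. repeat split; try lra. simpl in Hj. apply pow_nonzero. lra.
Qed.

(** By [quotient_rec] the product of [z - z0] with the partial sums of the
    quotient telescopes to the partial sums of [a], up to a multiple of the last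
    term, which tends to 0. *)
Lemma psum_quotient a z0 z :
  summable a -> Cmod z0 < 1 -> Cmod z < 1 ->
  psum a z = (psum a z0 + (z - z0) * psum (quotient z0 a) z)%C.
Proof.
  intros Ha Hz0 Hz. set (c := quotient z0 a).
  assert (Hc : summable c) by now apply quotient_summable.
  assert (E : forall n, csum a z (S n) =
     (psum a z0 + (z - z0) * csum c z n - z0 * (c n * z ^ n))%C).
  { induction n.
    - simpl. unfold c. rewrite psum_shift by auto.
      change (psum (shift 1 a) z0) with (quotient z0 a 0). ring.
    - change (csum a z (S (S n))) with (csum a z (S n) + a (S n) * z ^ (S n))%C.
      rewrite IHn. simpl. unfold c at 2. rewrite (quotient_rec z0 a n) by auto. fold c.
      unfold c at 4. rewrite (quotient_rec z0 a n) by auto. fold c. ring. }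
  apply psum_unique; auto. apply clim_incr_1.
  apply clim_ext with (1 := fun n => eq_sym (E n)).
  replace (psum a z0 + (z - z0) * psum c z)%C with
    ((psum a z0 + (z - z0) * psum c z) - z0 * (psum c z - psum c z))%C by ring.
  assert (Hl := psum_clim c z Hc Hz).
  apply clim_minus.
  - apply clim_plus. apply clim_const. now apply clim_scal.
  - apply clim_scal. apply clim_ext with (fun n => csum c z (S n) - csum c z n)%C.
    intros n; simpl; ring. apply clim_minus; auto. now apply clim_incr_1.
Qed.

Lemma clim_of_mod (u : nat -> C) : is_lim_seq (fun n => Cmod (u n)) 0 -> clim u 0.
Proof.
  intros H. unfold clim. apply is_lim_seq_ext with (2 := H).
  intros n. f_equal. ring.
Qed.

Lemma nat_term_lim a z :
  summable a -> Cmod z < 1 -> clim (fun n => INR n * a n * z ^ n)%C 0.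
Proof.
  intros Ha Hz. apply clim_of_mod.
  apply is_lim_seq_ext with (2 := summable_term_lim a z Ha Hz).
  intros n. rewrite !Cmod_mult, Cmod_pow, Cmod_R, Rabs_pos_eq. ring. apply pos_INR.
Qed.

(** Summation by parts, after writing [a_(n+1)] as [c_n - z0 c_(n+1)] in terms
    of the coefficients [c] of the quotient. *)
Lemma csum_derived_quotient a z0 n :
  summable a -> Cmod z0 < 1 ->
  csum (derived a) z0 n =
  (csum (quotient z0 a) z0 n - INR n * quotient z0 a n * z0 ^ n)%C.
Proof.
  intros Ha Hz. induction n.
  - simpl. ring.
  - simpl csum. rewrite IHn. unfold derived.
    rewrite (quotient_rec z0 a n) by auto. rewrite S_INR, RtoC_plus. simpl. ring.
Qed.

Lemma clim_derived a z :
  summable a -> Cmod z < 1 -> clim (csum (derived a) z) (psum (quotient z a) z).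
Proof.
  intros Ha Hz.
  apply clim_ext with (1 := fun n => eq_sym (csum_derived_quotient a z n Ha Hz)).
  replace (psum (quotient z a) z) with (psum (quotient z a) z - 0)%C by ring.
  assert (Hq := quotient_summable z a Ha Hz).
  apply clim_minus. now apply psum_clim. now apply nat_term_lim.
Qed.

Lemma derived_summable a : summable a -> summable (derived a).
Proof.
  intros Ha. apply clim_summable with (fun z => psum (quotient z a) z).
  intros z Hz. now apply clim_derived.
Qed.

(** The value of the difference quotient at its base point, which is the complex
    derivative, is thus computed by differentiating term by term. *)
Lemma psum_derived a z :
  summable a -> Cmod z < 1 -> psum (derived a) z = psum (quotient z a) z.
Proof.
  intros Ha Hz. apply psum_unique; auto. now apply derived_summable. now apply clim_derived.
Qed.

(** Summation by parts as in [csum_derived_quotient]; the weights combine to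
    [(n+1) (n+2) - n (n+1) = 2 (n+1)], those of a first derivative. *)
Lemma csum_derived2_quotient a z0 n :
  summable a -> Cmod z0 < 1 ->
  csum (derived (derived a)) z0 n =
  (2 * csum (derived (quotient z0 a)) z0 n
   - INR n * derived (quotient z0 a) n * z0 ^ n)%C.
Proof.
  intros Ha Hz. induction n.
  - simpl. ring.
  - simpl csum. rewrite IHn. unfold derived.
    rewrite (quotient_rec z0 a (S n)) by auto. rewrite !S_INR, !RtoC_plus. simpl. ring.
Qed.

Lemma psum_derived2 a z :
  summable a -> Cmod z < 1 ->
  psum (derived (derived a)) z = (2 * psum (quotient z (quotient z a)) z)%C.
Proof.
  intros Ha Hz. assert (Hq := quotient_summable z a Ha Hz).
  assert (Hd := derived_summable _ Hq).
  apply psum_unique; auto. now apply derived_summable, derived_summable.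
  apply clim_ext with (1 := fun n => eq_sym (csum_derived2_quotient a z n Ha Hz)).
  rewrite <- psum_derived by auto.
  replace (2 * psum (derived (quotient z a)) z)%C
    with (2 * psum (derived (quotient z a)) z - 0)%C by ring.
  apply clim_minus. apply clim_scal. now apply psum_clim. now apply nat_term_lim.
Qed.

(** * Taylor expansions and their calculus *)

Definition near (z : C) (P : C -> Prop) : Prop :=
  exists d, 0 < d /\ forall w, Cmod (w - z)%C < d -> P w.

(** Continuity with respect to the modulus, not to the coordinatewise balls of
    [R * R]. *)
Definition cont (h : C -> C) (z : C) : Prop :=
  forall e, 0 < e -> near z (fun w => Cmod (h w - h z)%C < e).

Lemma near_and z (P Q : C -> Prop) : near z P -> near z Q -> near z (fun w => P w /\ Q w).
Proof.
  intros (d1 & H1 & P1) (d2 & H2 & P2). exists (Rmin d1 d2). split.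
  now apply Rmin_glb_lt.
  intros w Hw. split. apply P1. eapply Rlt_le_trans; eauto. apply Rmin_l.
  apply P2. eapply Rlt_le_trans; eauto. apply Rmin_r.
Qed.

Lemma near_imp z (P Q : C -> Prop) : (forall w, P w -> Q w) -> near z P -> near z Q.
Proof. intros H (d & Hd & Hp). exists d. split; auto. Qed.

Lemma near_all z (P : C -> Prop) : (forall w, P w) -> near z P.
Proof. intros H. exists 1. split. lra. auto. Qed.

Lemma Cmod_refl z : Cmod (z - z)%C = 0.
Proof. replace (z - z)%C with (RtoC 0) by ring. apply Cmod_0. Qed.

Lemma near_self z (P : C -> Prop) : near z P -> P z.
Proof. intros (d & Hd & Hp). apply Hp. now rewrite Cmod_refl. Qed.

Lemma near_disc z c r : Cmod (z - c)%C < r -> near z (fun w => Cmod (w - c)%C < r).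
Proof.
  intros H. exists (r - Cmod (z - c)%C). split. lra. intros w Hw.
  replace (w - c)%C with ((w - z) + (z - c))%C by ring.
  eapply Rle_lt_trans. apply Cmod_triangle. lra.
Qed.

Lemma near_disk z : Cmod z < 1 -> near z (fun w => Cmod w < 1).
Proof.
  intros H. apply near_imp with (fun w => Cmod (w - 0)%C < 1).
  intros w. now replace (w - 0)%C with w by ring.
  apply near_disc. now replace (z - 0)%C with z by ring.
Qed.

Lemma near_cont h z (P : C -> Prop) : cont h z -> near (h z) P -> near z (fun w => P (h w)).
Proof.
  intros Hc (d & Hd & Hp). apply near_imp with (2 := Hc d Hd). auto.
Qed.

Lemma cont_ext h g z : near z (fun w => h w = g w) -> cont h z -> cont g z.
Proof.
  intros Hn Hc e He. assert (E := near_self _ _ Hn). simpl in E.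
  apply near_imp with (2 := near_and _ _ _ Hn (Hc e He)).
  intros w [E1 H]. now rewrite <- E, <- E1.
Qed.

Lemma cont_const c z : cont (fun _ => c) z.
Proof. intros e He. apply near_all. intros w. now rewrite Cmod_refl. Qed.

Lemma cont_id z : cont (fun w => w) z.
Proof. intros e He. exists e. auto. Qed.

Lemma cont_plus h g z : cont h z -> cont g z -> cont (fun w => h w + g w)%C z.
Proof.
  intros Hh Hg e He.
  apply near_imp with (2 := near_and _ _ _ (Hh (e / 2) ltac:(lra)) (Hg (e / 2) ltac:(lra))).
  intros w [H1 H2].
  replace (h w + g w - (h z + g z))%C with ((h w - h z) + (g w - g z))%C by ring.
  eapply Rle_lt_trans. apply Cmod_triangle. lra.
Qed.

Lemma Cmult_close (a b : C) e :
  0 < e -> exists d, 0 < d /\ forall x y,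
    Cmod (x - a)%C < d -> Cmod (y - b)%C < d -> Cmod (x * y - a * b)%C < e.
Proof.
  intros He. set (K := Cmod a + Cmod b + 1).
  assert (Ha := Cmod_ge_0 a). assert (Hb := Cmod_ge_0 b).
  assert (HK : 0 < 2 * K) by (unfold K; lra).
  assert (He2 : 0 < e / (2 * K)) by now apply Rdiv_lt_0_compat.
  exists (Rmin 1 (e / (2 * K))). split. apply Rmin_glb_lt; lra.
  intros x y Hx Hy.
  assert (H1 := Rlt_le_trans _ _ _ Hx (Rmin_r _ _)).
  assert (H2 := Rlt_le_trans _ _ _ Hy (Rmin_r _ _)).
  assert (H3 := Rlt_le_trans _ _ _ Hy (Rmin_l _ _)).
  replace (x * y - a * b)%C with ((x - a) * (b + (y - b)) + a * (y - b))%C by ring.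
  eapply Rle_lt_trans. apply Cmod_triangle. rewrite !Cmod_mult.
  assert (H4 : Cmod (b + (y - b))%C <= K).
  { eapply Rle_trans. apply Cmod_triangle. unfold K; lra. }
  assert (H5 : Cmod a <= K) by (unfold K; lra).
  apply Rlt_le_trans with (e / (2 * K) * K + K * (e / (2 * K))).
  2: right; field; lra.
  assert (0 <= Cmod (x - a)%C) by apply Cmod_ge_0.
  assert (0 <= Cmod (y - b)%C) by apply Cmod_ge_0.
  apply Rplus_lt_le_compat.
  - apply Rle_lt_trans with (Cmod (x - a)%C * K).
    now apply Rmult_le_compat_l. apply Rmult_lt_compat_r; lra.
  - apply Rmult_le_compat; lra.
Qed.

Lemma cont_mult h g z : cont h z -> cont g z -> cont (fun w => h w * g w)%C z.
Proof.
  intros Hh Hg e He. destruct (Cmult_close (h z) (g z) e He) as (d & Hd & H).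
  apply near_imp with (2 := near_and _ _ _ (Hh _ Hd) (Hg _ Hd)).
  intros w [H1 H2]. auto.
Qed.

Lemma cont_inv h z : cont h z -> h z <> 0%C -> cont (fun w => / h w)%C z.
Proof.
  intros Hh Hz e He. apply Cmod_gt_0 in Hz.
  set (m := Cmod (h z)) in *.
  assert (He2 : 0 < e * (m / 2 * m)).
  { apply Rmult_lt_0_compat; auto. apply Rmult_lt_0_compat; lra. }
  apply near_imp with (2 := near_and _ _ _ (Hh _ He2) (Hh (m / 2) ltac:(lra))).
  intros w (H1 & H2).
  assert (H3 : m / 2 < Cmod (h w)).
  { assert (H := Cmod_triangle (h w) (h z - h w)%C).
    replace (h w + (h z - h w))%C with (h z) in H by ring.
    replace (h z - h w)%C with (- (h w - h z))%C in H by ring. rewrite Cmod_opp in H.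
    fold m in H. lra. }
  assert (h w <> 0%C) by (apply Cmod_gt_0; lra).
  assert (h z <> 0%C) by (apply Cmod_gt_0; auto).
  replace (/ h w - / h z)%C with (- (h w - h z) / (h w * h z))%C by (field; auto).
  rewrite Cmod_div, Cmod_mult, Cmod_opp by now apply Cmult_neq_0. fold m.
  apply (Rmult_lt_reg_r (Cmod (h w) * m)). apply Rmult_lt_0_compat; lra.
  unfold Rdiv. rewrite Rmult_assoc, Rinv_l, Rmult_1_r.
  2: { apply Rgt_not_eq, Rmult_lt_0_compat; lra. }
  apply Rlt_trans with (1 := H1). apply Rmult_lt_compat_l; auto.
Qed.

Lemma cont_comp h g z : cont h z -> cont g (h z) -> cont (fun w => g (h w)) z.
Proof. intros Hh Hg e He. apply (near_cont h z (fun v => Cmod (g v - g (h z))%C < e)); auto. Qed.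

Lemma cont_opp h z : cont h z -> cont (fun w => - h w)%C z.
Proof.
  intros H. apply cont_ext with (fun w => (-(1)) * h w)%C.
  apply near_all; intros; ring. apply cont_mult; auto. apply cont_const.
Qed.

Lemma cont_minus h g z : cont h z -> cont g z -> cont (fun w => h w - g w)%C z.
Proof. intros; apply cont_plus; auto. now apply cont_opp. Qed.

Lemma cont_div h g z : cont h z -> cont g z -> g z <> 0%C -> cont (fun w => h w / g w)%C z.
Proof. intros; apply cont_mult; auto. now apply cont_inv. Qed.

(** Taylor expansion of order [n] in Caratheodory's form: the difference
    quotient itself has an expansion of order [n - 1].  With this form, instead
    of a remainder estimate, every rule of calculus below is an induction whose
    step is an algebraic identity. *)
Fixpoint taylor (n : nat) (h : C -> C) (z : C) : Prop :=
  match n with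
  | O => cont h z
  | S k => exists h1, near z (fun w => h w = (h z + (w - z) * h1 w)%C) /\ taylor k h1 z
  end.

Lemma taylor_ext n h g z : near z (fun w => h w = g w) -> taylor n h z -> taylor n g z.
Proof.
  destruct n; simpl. apply cont_ext.
  intros Hn (h1 & H1 & H2). exists h1. split; auto.
  assert (E := near_self _ _ Hn). simpl in E.
  apply near_imp with (2 := near_and _ _ _ Hn H1).
  intros w [E1 H]. now rewrite <- E, <- E1.
Qed.

Lemma taylor_cont n h z : taylor n h z -> cont h z.
Proof.
  revert h. induction n; simpl; auto. intros h (h1 & H1 & H2).
  apply cont_ext with (fun w => h z + (w - z) * h1 w)%C.
  apply near_imp with (2 := H1); auto.
  apply cont_plus. apply cont_const. apply cont_mult.
  apply cont_minus. apply cont_id. apply cont_const. auto.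
Qed.

Lemma taylor_weaken n h z : taylor (S n) h z -> taylor n h z.
Proof.
  revert h. induction n; intros h.
  - apply (taylor_cont 1).
  - intros (h1 & H1 & H2). exists h1. split; auto.
Qed.

Lemma taylor_le m n h z : (m <= n)%nat -> taylor n h z -> taylor m h z.
Proof. induction 1; auto. intros; apply IHle. now apply taylor_weaken. Qed.

Lemma taylor_const n c z : taylor n (fun _ => c) z.
Proof.
  revert c. induction n; intros c. apply cont_const.
  exists (fun _ => 0%C). split; auto. apply near_all. intros; ring.
Qed.

Lemma taylor_id n z : taylor n (fun w => w) z.
Proof.
  destruct n. apply cont_id. exists (fun _ => 1%C). split. apply near_all; intros; ring.
  apply taylor_const.
Qed.

Lemma taylor_plus n h g z : taylor n h z -> taylor n g z -> taylor n (fun w => h w + g w)%C z.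
Proof.
  revert h g. induction n; intros h g.
  - apply cont_plus.
  - intros (h1 & H1 & H2) (g1 & G1 & G2). exists (fun w => h1 w + g1 w)%C. split; auto.
    apply near_imp with (2 := near_and _ _ _ H1 G1). intros w [E1 E2].
    rewrite E1, E2 at 1. ring.
Qed.

Lemma taylor_mult n h g z : taylor n h z -> taylor n g z -> taylor n (fun w => h w * g w)%C z.
Proof.
  revert h g. induction n; intros h g.
  - apply cont_mult.
  - intros H G. assert (G' := taylor_weaken _ _ _ G).
    destruct H as (h1 & H1 & H2), G as (g1 & G1 & G2).
    exists (fun w => h1 w * g w + h z * g1 w)%C. split.
    + apply near_imp with (2 := near_and _ _ _ H1 G1). intros w [E1 E2].
      rewrite E1. rewrite E2. ring.
    + apply taylor_plus; auto. apply IHn; auto. apply taylor_const.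
Qed.

(** The difference quotient of [1 / h] is [- h1 / (h z * h)]. *)
Lemma taylor_inv n h z : taylor n h z -> h z <> 0%C -> taylor n (fun w => / h w)%C z.
Proof.
  revert h. induction n; intros h.
  - apply cont_inv.
  - intros H Hz. assert (H' := taylor_weaken _ _ _ H). assert (Hc := taylor_cont _ _ _ H).
    destruct H as (h1 & H1 & H2).
    exists (fun w => (- / h z) * (h1 w * / h w))%C. split.
    + assert (Hn : near z (fun w => h w <> 0%C)).
      { apply Cmod_gt_0 in Hz. apply near_imp with (2 := Hc _ Hz).
        intros w Hw E. rewrite E in Hw. replace (0 - h z)%C with (- h z)%C in Hw by ring.
        rewrite Cmod_opp in Hw. lra. }
      apply near_imp with (2 := near_and _ _ _ H1 Hn). intros w [E1 E2].
      transitivity (/ h z - (h w - h z) * (/ h z * / h w))%C. field; auto.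
      rewrite E1 at 1. ring.
    + apply taylor_mult. apply taylor_const. apply taylor_mult; auto.
Qed.

Lemma taylor_minus n h g z : taylor n h z -> taylor n g z -> taylor n (fun w => h w - g w)%C z.
Proof.
  intros H G. apply taylor_ext with (fun w => h w + (-(1)) * g w)%C.
  apply near_all; intros; ring. apply taylor_plus; auto. apply taylor_mult; auto.
  apply taylor_const.
Qed.

Lemma taylor_div n h g z :
  taylor n h z -> taylor n g z -> g z <> 0%C -> taylor n (fun w => h w / g w)%C z.
Proof. intros; apply taylor_mult; auto. now apply taylor_inv. Qed.

(** The difference quotient of [g o h] is [h1 * (g1 o h)]. *)
Lemma taylor_comp n h g z : taylor n h z -> taylor n g (h z) -> taylor n (fun w => g (h w)) z.
Proof.
  revert g. induction n; intros g.
  - apply cont_comp.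
  - intros H (g1 & G1 & G2). assert (H' := taylor_weaken _ _ _ H).
    assert (Hc := taylor_cont _ _ _ H).
    destruct H as (h1 & H1 & H2). exists (fun w => h1 w * g1 (h w))%C. split.
    + apply near_imp with (2 := near_and _ _ _ H1 (near_cont _ _ _ Hc G1)).
      intros w [E1 E2]. rewrite E2. rewrite E1 at 1. ring.
    + apply taylor_mult; auto.
Qed.

(** The difference quotients satisfy [g1 = h1 * (f1 o h)].  Solving for [h1]
    shows that an expansion of [h] of order [m] yields one of order [m + 1];
    continuity of [h] starts the induction. *)
Lemma taylor_implicit n f h g z f1 :
  cont h z -> near z (fun w => f (h w) = g w) -> taylor n g z ->
  near (h z) (fun v => f v = (f (h z) + (v - h z) * f1 v)%C) ->
  f1 (h z) <> 0%C -> taylor n f1 (h z) -> taylor n h z.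
Proof.
  intros Hc E G Hf Hne Hf1.
  assert (main : forall m, (m <= n)%nat -> taylor m h z).
  { induction m; intros Hm. auto.
    assert (Hh := IHm ltac:(lia)).
    assert (Gm := taylor_le (S m) n _ _ Hm G). destruct Gm as (g1 & G1 & G2).
    exists (fun w => g1 w / f1 (h w))%C. split.
    - assert (Hcf : cont (fun w => f1 (h w)) z).
      { apply cont_comp; auto. now apply taylor_cont with n. }
      assert (Hn : near z (fun w => f1 (h w) <> 0%C)).
      { apply Cmod_gt_0 in Hne. apply near_imp with (2 := Hcf _ Hne).
        intros w Hw Ez. rewrite Ez in Hw. replace (0 - f1 (h z))%C with (- f1 (h z))%C in Hw by ring.
        rewrite Cmod_opp in Hw. lra. }
      assert (Ez := near_self _ _ E). simpl in Ez.
      apply near_imp with (2 := near_and _ _ _ (near_and _ _ _ Hn E)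
         (near_and _ _ _ G1 (near_cont _ _ _ Hc Hf))).
      intros w ((W1 & W2) & W3 & W4).
      rewrite W2, W3, Ez in W4.
      assert (W5 : ((w - z) * g1 w)%C = ((h w - h z) * f1 (h w))%C).
      { replace ((h w - h z) * f1 (h w))%C with ((g z + (h w - h z) * f1 (h w)) - g z)%C by ring.
        rewrite <- W4. ring. }
      replace ((w - z) * (g1 w / f1 (h w)))%C with ((w - z) * g1 w / f1 (h w))%C by (unfold Cdiv; ring).
      rewrite W5. field. auto.
    - apply taylor_div; auto. apply taylor_comp; auto. apply taylor_le with n; auto. lia. }
  apply main; auto.
Qed.

(** Power series have expansions of every order because their difference
    quotients are again power series. *)
Lemma psum_taylor n a z : summable a -> Cmod z < 1 -> taylor n (psum a) z.
Proof.
  intros Ha Hz. revert a Ha. induction n; intros a Ha.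
  - intros e He. assert (Hq := quotient_summable z a Ha Hz).
    set (rho := (1 + Cmod z) / 2).
    destruct (psum_locally_bounded (quotient z a) rho Hq) as (M & HM & Hb). unfold rho; lra.
    exists (Rmin ((1 - Cmod z) / 2) (e / M)). split.
    apply Rmin_glb_lt. lra. now apply Rdiv_lt_0_compat.
    intros w Hw.
    assert (H1 := Rlt_le_trans _ _ _ Hw (Rmin_l _ _)).
    assert (H2 := Rlt_le_trans _ _ _ Hw (Rmin_r _ _)).
    assert (Hwr : Cmod w <= rho).
    { replace w with ((w - z) + z)%C by ring. eapply Rle_trans. apply Cmod_triangle.
      unfold rho; lra. }
    rewrite (psum_quotient a z w); auto. 2: unfold rho in Hwr; lra.
    replace (psum a z + (w - z) * psum (quotient z a) w - psum a z)%C
      with ((w - z) * psum (quotient z a) w)%C by ring.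
    rewrite Cmod_mult.
    apply Rle_lt_trans with (Cmod (w - z)%C * M).
    apply Rmult_le_compat_l. apply Cmod_ge_0. auto.
    apply (Rmult_lt_compat_r M) in H2; auto. replace (e / M * M) with e in H2 by (field; lra). auto.
  - exists (psum (quotient z a)). split.
    + apply near_imp with (2 := near_disk z Hz). intros w Hw. now apply psum_quotient.
    + apply IHn. now apply quotient_summable.
Qed.

(** * The maximum modulus principle *)

Lemma functional_choice {A B : Type} (R : A -> B -> Prop) :
  (forall x, exists y, R x y) -> exists f : A -> B, forall x, R x (f x).
Proof.
  intros H. exists (fun x => proj1_sig (constructive_indefinite_description _ (H x))).
  intros x. apply proj2_sig.
Qed.

Lemma bolzano_weierstrass_R (x : nat -> R) B :
  (forall n, Rabs (x n) <= B) ->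
  exists l, forall e, 0 < e -> forall N, exists n, (N <= n)%nat /\ Rabs (x n - l) < e.
Proof.
  intros HB.
  destruct (Bolzano_Weierstrass x (fun c => - B <= c <= B) (compact_P3 _ _)) as [l Hl].
  { intros n. apply Rabs_le_between, HB. }
  exists l. intros e He N.
  destruct (Hl (disc l (mkposreal e He)) N) as (p & Hp1 & Hp2).
  { exists (mkposreal e He). intros y Hy; exact Hy. }
  exists p. split; auto.
Qed.

Lemma bolzano_weierstrass_C (z : nat -> C) B :
  (forall n, Cmod (z n) <= B) ->
  exists l, forall e, 0 < e -> forall N, exists n, (N <= n)%nat /\ Cmod (z n - l)%C < e.
Proof.
  intros HB.
  destruct (bolzano_weierstrass_R (fun n => Re (z n)) B) as [x Hx].
  { intros n. eapply Rle_trans. apply re_le_Cmod. auto. }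
  (* a subsequence along which the real parts converge to x *)
  destruct (functional_choice (fun k n => (k <= n)%nat /\ Rabs (Re (z n) - x) < / (INR k + 1))) as [phi Hphi].
  { intros k. apply Hx. apply Rinv_0_lt_compat. assert (H := pos_INR k). lra. }
  destruct (bolzano_weierstrass_R (fun k => Im (z (phi k))) B) as [y Hy].
  { intros n. eapply Rle_trans. apply im_le_Cmod. auto. }
  exists (x, y). intros e He N.
  destruct (archimed_cor1 (e / 2)) as (N0 & HN0 & HN0p). lra.
  destruct (Hy (e / 2) ltac:(lra) (N + N0)%nat) as (k & Hk & Hky).
  exists (phi k). destruct (Hphi k) as [H1 H2]. split. lia.
  eapply Rle_lt_trans. apply Cmod_le_re_im. simpl.
  assert (/ (INR k + 1) < / INR N0).
  { apply Rinv_lt_contravar. apply Rmult_lt_0_compat. now apply lt_0_INR.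
    assert (H := pos_INR k). lra.
    assert (INR N0 <= INR k) by (apply le_INR; lia). lra. }
  change (Rabs (Re (z (phi k)) - x) + Rabs (Im (z (phi k)) - y) < e). lra.
Qed.

Definition closed_C (K : C -> Prop) : Prop :=
  forall z, (forall e, 0 < e -> exists w, K w /\ Cmod (w - z)%C < e) -> K z.

(** A cluster point of a maximising sequence attains the supremum; a sequence
    with unbounded values would contradict semicontinuity at its cluster point. *)
Lemma extreme_value (K : C -> Prop) (u : C -> R) B :
  closed_C K -> (forall z, K z -> Cmod z <= B) -> (exists z, K z) ->
  (forall z, K z -> forall e, 0 < e -> near z (fun w => u w < u z + e)) ->
  exists z0, K z0 /\ forall z, K z -> u z <= u z0.
Proof.
  intros HK HB [zi Hzi] Hu.
  assert (lim : forall v : nat -> R, (forall n, exists z, K z /\ v n < u z) ->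
     exists l, K l /\ forall e, 0 < e -> forall N, exists n, (N <= n)%nat /\ v n < u l + e).
  { intros v Hv. destruct (functional_choice _ Hv) as [z Hz].
    destruct (bolzano_weierstrass_C z B) as [l Hl].
    { intros n. apply HB, Hz. }
    assert (HKl : K l).
    { apply HK. intros e He. destruct (Hl e He O) as (n & _ & Hn). exists (z n). split; auto. apply Hz. }
    exists l. split; auto. intros e He N.
    destruct (Hu l HKl e He) as (d & Hd & Hud).
    destruct (Hl d Hd N) as (n & Hn1 & Hn2). exists n. split; auto.
    specialize (Hud _ Hn2). destruct (Hz n). lra. }
  destruct (completeness (fun t => exists z, K z /\ t = u z)) as [M [HM1 HM2]].
  - apply NNPP. intros Hnb.
    destruct (lim INR) as (l & HKl & Hl).
    { intros n. apply NNPP. intros Hn. apply Hnb. exists (INR n).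
      intros t (z & Hz & ->). apply Rnot_lt_le. intros H. apply Hn. eauto. }
    destruct (nfloor_ex (Rabs (u l + 1))) as [N HN]. apply Rabs_pos.
    destruct (Hl 1 Rlt_0_1 (S N)) as (n & Hn1 & Hn2).
    apply le_INR in Hn1. rewrite S_INR in Hn1.
    assert (H := Rle_abs (u l + 1)). lra.
  - exists (u zi). eauto.
  - destruct (lim (fun n => M - / (INR n + 1))) as (l & HKl & Hl).
    { intros n. apply NNPP. intros Hn.
      assert (0 < / (INR n + 1)) by (apply Rinv_0_lt_compat; assert (H := pos_INR n); lra).
      assert (M <= M - / (INR n + 1)); [|lra].
      apply HM2. intros t (z & Hz & ->). apply Rnot_lt_le. intros H'. apply Hn. eauto. }
    exists l. split; auto. intros z Hz.
    apply Rle_trans with M. apply HM1. eauto.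
    apply Rnot_lt_le. intros Hlt.
    set (e := M - u l) in *.
    destruct (archimed_cor1 (e / 2)) as (N0 & HN0 & HN0p). unfold e; lra.
    destruct (Hl (e / 2) ltac:(unfold e; lra) N0) as (n & Hn1 & Hn2).
    assert (/ (INR n + 1) < / INR N0).
    { apply Rinv_lt_contravar. apply Rmult_lt_0_compat. now apply lt_0_INR.
      assert (H := pos_INR n). lra.
      assert (INR N0 <= INR n) by (apply le_INR; lia). lra. }
    unfold e in *. lra.
Qed.

Lemma closed_disc_closed c r : closed_C (fun z => Cmod (z - c)%C <= r).
Proof.
  intros z H. apply Rnot_lt_le. intros Hlt.
  destruct (H (Cmod (z - c)%C - r) ltac:(lra)) as (w & H1 & H2).
  assert (T := Cmod_triangle (w - c)%C (- (w - z))%C).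
  replace (w - c + - (w - z))%C with (z - c)%C in T by ring. rewrite Cmod_opp in T. lra.
Qed.

Lemma circle_closed c r : closed_C (fun z => Cmod (z - c)%C = r).
Proof.
  intros z H. apply Rle_antisym.
  - apply (closed_disc_closed c r). intros e He. destruct (H e He) as (w & H1 & H2).
    exists w. split; auto. lra.
  - apply Rnot_lt_le. intros Hlt.
    destruct (H (r - Cmod (z - c)%C) ltac:(lra)) as (w & H1 & H2).
    assert (T := Cmod_triangle (w - z)%C (z - c)%C).
    replace (w - z + (z - c))%C with (w - c)%C in T by ring. lra.
Qed.

Lemma Cmod_center_bound z c r : Cmod (z - c)%C <= r -> Cmod z <= Cmod c + r.
Proof.
  intros H. replace z with (c + (z - c))%C by ring.
  eapply Rle_trans. apply Cmod_triangle. lra.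
Qed.

Lemma Cmod_diff (a b : C) : Rabs (Cmod a - Cmod b) <= Cmod (a - b)%C.
Proof.
  apply Rabs_le_between. split.
  - assert (T := Cmod_triangle a (- (a - b))%C).
    replace (a + - (a - b))%C with b in T by ring. rewrite Cmod_opp in T. lra.
  - assert (T := Cmod_triangle b (a - b)%C).
    replace (b + (a - b))%C with a in T by ring. lra.
Qed.

Lemma circle_min c r (h : C -> C) :
  0 <= r -> (forall z, Cmod (z - c)%C = r -> cont h z) ->
  (forall z, Cmod (z - c)%C = r -> h z <> 0%C) ->
  exists m, 0 < m /\ forall z, Cmod (z - c)%C = r -> m <= Cmod (h z).
Proof.
  intros Hr Hc Hn.
  destruct (extreme_value (fun z => Cmod (z - c)%C = r) (fun z => - Cmod (h z)) (Cmod c + r))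
    as (z0 & H1 & H2).
  - apply circle_closed.
  - intros z Hz. apply Cmod_center_bound. lra.
  - exists (c + r)%C. replace (c + r - c)%C with (RtoC r) by ring.
    rewrite Cmod_R. now apply Rabs_pos_eq.
  - intros z Hz e He. apply near_imp with (2 := Hc z Hz e He). intros w Hw.
    assert (D := Cmod_diff (h w) (h z)). apply Rabs_le_between in D. lra.
  - exists (Cmod (h z0)). split. now apply Cmod_gt_0, Hn.
    intros z Hz. specialize (H2 z Hz). lra.
Qed.

Definition normsq (z : C) : R := Re z * Re z + Im z * Im z.

Lemma normsq_Cmod z : normsq z = Cmod z * Cmod z.
Proof. replace (Cmod z * Cmod z) with (Cmod z ^ 2) by ring. rewrite Cmod2_alt. unfold normsq. ring. Qed.

(** The first, second and third powers of [1], [i], [-1], [-i] sum to zero, so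
    the mixed terms cancel: a discrete form of the subharmonicity of the squared
    modulus. *)
Lemma four_point_average (A B D : C) (d : R) :
  normsq (A + B * d + D * (d * d))%C + normsq (A + B * (Ci * d) + D * ((Ci * d) * (Ci * d)))%C
  + normsq (A + B * (- d) + D * ((- d) * (- d)))%C
  + normsq (A + B * (- (Ci * d)) + D * ((- (Ci * d)) * (- (Ci * d))))%C
  = 4 * (normsq A + normsq B * d ^ 2 + normsq D * d ^ 4).
Proof.
  destruct A as [a1 a2], B as [b1 b2], D as [c1 c2].
  unfold normsq, Ci, RtoC, Re, Im, Cplus, Cmult, Copp. simpl. ring.
Qed.

Lemma normsq_perturb X E L r : Cmod X <= L -> Cmod E <= r -> 
  normsq X - 2 * L * r <= normsq (X + E)%C.
Proof.
  intros HX HE. rewrite !normsq_Cmod.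
  assert (0 <= Cmod X) by apply Cmod_ge_0. assert (0 <= Cmod E) by apply Cmod_ge_0.
  assert (T := Cmod_triangle (X + E)%C (- E)%C).
  replace (X + E + - E)%C with X in T by ring. rewrite Cmod_opp in T.
  assert (0 <= Cmod (X + E)%C) by apply Cmod_ge_0.
  assert (Cmod X * Cmod E <= L * r) by (apply Rmult_le_compat; auto).
  destruct (Rle_dec (Cmod E) (Cmod X)); nra.
Qed.

(** Averaging over four points at distance [d] does not decrease the quadratic
    part of [|h|^2] and adds exactly [eps * d^2] to the second term, which
    dominates the error of order [o(d^2)] of the expansion. *)
Lemma no_interior_max (h : C -> C) (z0 c : C) eps :
  0 < eps -> taylor 2 h z0 ->
  ~ near z0 (fun w => normsq (h w) + eps * normsq (w - c)%C <= normsq (h z0) + eps * normsq (z0 - c)%C).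
Proof.
  intros He (h1 & H1 & h2 & H2 & H3) Hmax.
  set (A := h z0) in *. set (B := h1 z0) in *. set (D := h2 z0) in *.
  set (L := Cmod A + Cmod B + Cmod D).
  assert (HL : 0 <= L).
  { assert (X1 := Cmod_ge_0 A). assert (X2 := Cmod_ge_0 B). assert (X3 := Cmod_ge_0 D). unfold L; lra. }
  (* [L] bounds the quadratic part near [z0]; this [r] gives [2 * L * r < eps], so that an
     error of size [r * d^2] in [h] cannot absorb the gain [eps * d^2] *)
  set (r := eps / (4 * (L + 1))).
  assert (Hr : 0 < r) by (apply Rdiv_lt_0_compat; lra).
  assert (HrL : 2 * L * r < eps).
  { unfold r. apply (Rmult_lt_reg_r (4 * (L + 1))). lra.
    replace (2 * L * (eps / (4 * (L + 1))) * (4 * (L + 1))) with (2 * L * eps) by (field; lra).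
    nra. }
  destruct (near_and _ _ _ (near_and _ _ _ H1 H2) (near_and _ _ _ (H3 r Hr) Hmax)) as (d0 & Hd0 & Hn).
  set (d := Rmin (d0 / 2) 1).
  assert (Hd : 0 < d) by (apply Rmin_glb_lt; lra).
  assert (Hd1 : d <= 1) by apply Rmin_r.
  assert (Hd2 : d < d0). { apply Rle_lt_trans with (d0 / 2). apply Rmin_l. lra. }
  assert (P : forall p : C, Cmod p = d ->
     normsq (A + B * p + D * (p * p))%C - 2 * L * (r * d ^ 2) + eps * normsq (z0 - c + p)%C
     <= normsq A + eps * normsq (z0 - c)%C).
  { intros p Hp. specialize (Hn (z0 + p)%C).
    replace (z0 + p - z0)%C with p in Hn by ring.
    destruct (Hn ltac:(lra)) as ((E1 & E2) & E3 & E4). fold A B D in E3, E4.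
    assert (E : h (z0 + p)%C = ((A + B * p + D * (p * p)) + (p * p) * (h2 (z0 + p) - D))%C).
    { rewrite E1, E2. replace (z0 + p - z0)%C with p by ring. fold A B. ring. }
    rewrite E in E4. replace (z0 + p - c)%C with (z0 - c + p)%C in E4 by ring.
    eapply Rle_trans. 2: exact E4. apply Rplus_le_compat_r. apply normsq_perturb.
    - eapply Rle_trans. apply Cmod_triangle. unfold L. rewrite Cmod_mult, Cmod_mult, Hp.
      apply Rplus_le_compat.
      + eapply Rle_trans. apply Cmod_triangle. rewrite Cmod_mult, Hp.
        assert (X := Cmod_ge_0 B). nra.
      + assert (X := Cmod_ge_0 D). assert (d * d <= 1) by nra. nra.
    - rewrite !Cmod_mult, Hp. replace (r * d ^ 2) with (d * d * r) by ring.
      apply Rmult_le_compat_l. nra. lra. }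
  assert (P1 := P (RtoC d)). assert (P2 := P (Ci * d)%C).
  assert (P3 := P (- d)%C). assert (P4 := P (- (Ci * d))%C).
  rewrite ?Cmod_opp, ?Cmod_mult, ?Cmod_Ci, ?Cmod_R, ?Rabs_pos_eq in * by lra.
  specialize (P1 eq_refl). specialize (P2 ltac:(lra)). specialize (P3 eq_refl).
  specialize (P4 ltac:(lra)).
  assert (S1 := four_point_average A B D d).
  assert (S2 := four_point_average (z0 - c)%C 1 0 d).
  assert (N1 : normsq 1%C = 1) by (unfold normsq; simpl; ring).
  assert (N0 : normsq 0%C = 0) by (unfold normsq; simpl; ring).
  rewrite N1, N0 in S2.
  replace (z0 - c + 1 * d + 0 * (d * d))%C with (z0 - c + d)%C in S2 by ring.
  replace (z0 - c + 1 * (Ci * d) + 0 * (Ci * d * (Ci * d)))%C with (z0 - c + Ci * d)%C in S2 by ring.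
  replace (z0 - c + 1 * - d + 0 * (- d * - d))%C with (z0 - c + - d)%C in S2 by ring.
  replace (z0 - c + 1 * - (Ci * d) + 0 * (- (Ci * d) * - (Ci * d)))%C with (z0 - c + - (Ci * d))%C in S2 by ring.
  assert (0 <= normsq B * d ^ 2).
  { apply Rmult_le_pos. unfold normsq; nra. nra. }
  assert (0 <= normsq D * d ^ 4).
  { apply Rmult_le_pos. unfold normsq; nra. apply pow_le; lra. }
  assert (Hdd : 0 < d ^ 2) by nra.
  assert (2 * L * (r * d ^ 2) < eps * d ^ 2).
  { replace (2 * L * (r * d ^ 2)) with (2 * L * r * d ^ 2) by ring. now apply Rmult_lt_compat_r. }
  nra.
Qed.

(** Were the bound violated inside, [|h|^2 + eps |z - c|^2] would, for small
    [eps], have its maximum in the open disc. *)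
Theorem maximum_modulus (c : C) (s m : R) (h : C -> C) :
  0 <= s ->
  (forall z, Cmod (z - c)%C <= s -> cont h z) ->
  (forall z, Cmod (z - c)%C < s -> taylor 2 h z) ->
  (forall z, Cmod (z - c)%C = s -> Cmod (h z) <= m) ->
  forall z, Cmod (z - c)%C <= s -> Cmod (h z) <= m.
Proof.
  intros Hs Hc Ht Hb z Hz. apply Rnot_lt_le. intros Hlt.
  assert (Hm : 0 <= m).
  { assert (E : Cmod (c + s - c)%C = s).
    { replace (c + s - c)%C with (RtoC s) by ring. rewrite Cmod_R. now apply Rabs_pos_eq. }
    apply Rle_trans with (2 := Hb _ E). apply Cmod_ge_0. }
  set (gap := Cmod (h z) * Cmod (h z) - m * m).
  assert (Hgap : 0 < gap) by (unfold gap; nra).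
  (* on the boundary circle the second term contributes [eps * s^2], less than the gap *)
  set (eps := gap / (2 * (s * s + 1))).
  assert (He : 0 < eps) by (apply Rdiv_lt_0_compat; nra).
  assert (Hes : eps * (s * s) < gap).
  { unfold eps. apply (Rmult_lt_reg_r (2 * (s * s + 1))). nra.
    replace (gap / (2 * (s * s + 1)) * (s * s) * (2 * (s * s + 1))) with (gap * (s * s)) by (field; nra).
    nra. }
  set (u := fun w => normsq (h w) + eps * normsq (w - c)%C).
  destruct (extreme_value (fun w => Cmod (w - c)%C <= s) u (Cmod c + s)) as (z0 & Hz0 & Hmax).
  - apply closed_disc_closed.
  - intros w Hw. now apply Cmod_center_bound.
  - now exists z.
  - intros w Hw e He'.
    assert (C1 : cont (fun v => h v * Cconj (h v) + eps * ((v - c) * Cconj (v - c)))%C w).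
    { assert (Hconj : forall g, cont g w -> cont (fun v => Cconj (g v)) w).
      { intros g Hg e1 He1. apply near_imp with (2 := Hg e1 He1). intros v Hv.
        rewrite <- Cminus_conj, Cmod_conj. auto. }
      assert (cont (fun v => v - c)%C w) by (apply cont_minus; [apply cont_id|apply cont_const]).
      apply cont_plus. apply cont_mult; auto. apply cont_mult. apply cont_const.
      apply cont_mult; auto. }
    apply near_imp with (2 := C1 e He'). intros v Hv.
    assert (E : forall v, (h v * Cconj (h v) + eps * ((v - c) * Cconj (v - c)))%C = RtoC (u v)).
    { intros x. unfold u. rewrite !normsq_Cmod, RtoC_plus, RtoC_mult.
      rewrite <- !Cmod2_conj. do 2 f_equal. simpl. rewrite !RtoC_mult. ring. simpl. rewrite !RtoC_mult; ring. }
    rewrite !E in Hv. rewrite <- RtoC_minus, Cmod_R in Hv.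
    apply Rabs_def2 in Hv. lra.
  - assert (Hlow : normsq (h z) <= u z0).
    { apply Rle_trans with (2 := Hmax z Hz). unfold u.
      assert (0 <= normsq (z - c)%C) by (unfold normsq; nra). nra. }
    rewrite normsq_Cmod in Hlow.
    destruct (Rle_lt_or_eq_dec _ _ Hz0) as [Hin|Hon].
    + apply (no_interior_max h z0 c eps); auto.
      apply near_imp with (2 := near_disc _ _ _ Hin). intros w Hw. apply (Hmax w). lra.
    + assert (u z0 <= m * m + eps * (s * s)).
      { unfold u. rewrite !normsq_Cmod, Hon. specialize (Hb _ Hon).
        assert (X := Cmod_ge_0 (h z0)). nra. }
      unfold gap in *. lra.
Qed.

(** Without a zero, [1 / h] would violate the maximum modulus principle.  This
    takes the place of the argument principle: it gives solutions of equations
    that depend on a small parameter. *)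
Theorem zero_in_disc (c : C) (s m : R) (h : C -> C) :
  0 <= s ->
  (forall z, Cmod (z - c)%C <= s -> taylor 2 h z) ->
  (forall z, Cmod (z - c)%C = s -> m <= Cmod (h z)) ->
  Cmod (h c) < m ->
  exists z, Cmod (z - c)%C < s /\ h z = 0%C.
Proof.
  intros Hs Ht Hb Hcm. apply NNPP. intros Hno.
  assert (Hm : 0 < m) by (apply Rle_lt_trans with (2 := Hcm); apply Cmod_ge_0).
  assert (Hnz : forall z, Cmod (z - c)%C <= s -> h z <> 0%C).
  { intros z Hz E. destruct (Rle_lt_or_eq_dec _ _ Hz) as [Hin|Hon].
    apply Hno. eauto. specialize (Hb z Hon). rewrite E, Cmod_0 in Hb. lra. }
  assert (Hcc : Cmod (c - c)%C <= s) by now rewrite Cmod_refl.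
  assert (M := maximum_modulus c s (/ m) (fun z => / h z)%C Hs).
  assert (Cmod (/ h c)%C <= / m).
  { apply M; auto.
    - intros z Hz. apply cont_inv; auto. apply (taylor_cont 2); auto.
    - intros z Hz. apply taylor_inv. apply Ht; lra. apply Hnz; lra.
    - intros z Hz. rewrite Cmod_inv by (apply Hnz; lra). apply Rinv_le_contravar; auto. }
  rewrite Cmod_inv in H by auto.
  assert (0 < Cmod (h c)) by now apply Cmod_gt_0, Hnz.
  assert (/ m < / Cmod (h c)) by (apply Rinv_lt_contravar; auto; now apply Rmult_lt_0_compat).
  lra.
Qed.

(** * Mean value inequalities and the Schwarz lemma *)

Lemma nonincreasing_of_derive (F F' : R -> R) s0 s1 :
  s0 <= s1 -> (forall s, s0 <= s <= s1 -> is_derive F s (F' s)) ->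
  (forall s, s0 <= s <= s1 -> F' s <= 0) -> F s1 <= F s0.
Proof.
  intros Hs HF Hn.
  destruct (MVT_gen F s0 s1 F') as (c & Hc & E).
  - intros x Hx. rewrite Rmin_left, Rmax_right in Hx by auto. apply HF. lra.
  - intros x Hx. rewrite Rmin_left, Rmax_right in Hx by auto.
    apply continuity_pt_filterlim. apply (ex_derive_continuous (K := R_AbsRing) (V := R_NormedModule)). exists (F' x). now apply HF.
  - rewrite Rmin_left, Rmax_right in Hc by auto. specialize (Hn c Hc). nra.
Qed.

(** Taking [u = 1] and [u = -i] gives the real and the imaginary part; a general
    [u] gives the component in any direction. *)
Lemma psum_path_derive a (u z v : C) (s : R) :
  summable a -> Cmod (z + s * v)%C < 1 ->
  is_derive (fun x : R => Re (u * psum a (z + x * v))%C) s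
    (Re (u * (v * psum (derived a) (z + s * v)))%C).
Proof.
  intros Ha Hz. set (w0 := (z + s * v)%C) in *.
  rewrite psum_derived by auto. set (q := psum (quotient w0 a)).
  assert (Hq : cont q w0).
  { apply (taylor_cont 0). apply psum_taylor; auto. now apply quotient_summable. }
  apply is_derive_Reals. intros eps Heps.
  set (K := Cmod u * Cmod v + 1).
  assert (HK : 0 < K).
  { assert (X := Rmult_le_pos _ _ (Cmod_ge_0 u) (Cmod_ge_0 v)). unfold K; lra. }
  destruct (near_and _ _ _ (Hq (eps / K) (Rdiv_lt_0_compat _ _ Heps HK)) (near_disk _ Hz))
    as (d & Hd & Hn).
  assert (HV : 0 < Cmod v + 1) by (assert (X := Cmod_ge_0 v); lra).
  exists (mkposreal _ (Rdiv_lt_0_compat _ _ Hd HV)). intros h Hh0 Hh. simpl in Hh. cbv beta. fold w0.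
  assert (Hw : Cmod (z + (s + h)%R * v - w0)%C < d).
  { replace (z + (s + h)%R * v - w0)%C with (h * v)%C by (unfold w0; rewrite RtoC_plus; ring).
    rewrite Cmod_mult, Cmod_R.
    apply Rle_lt_trans with (Rabs h * (Cmod v + 1)).
    apply Rmult_le_compat_l. apply Rabs_pos. lra.
    apply (Rmult_lt_compat_r (Cmod v + 1)) in Hh; auto.
    replace (d / (Cmod v + 1) * (Cmod v + 1)) with d in Hh by (field; lra). auto. }
  destruct (Hn _ Hw) as [H1 H2].
  set (w := (z + (s + h)%R * v)%C) in *.
  rewrite (psum_quotient a w0 w) by auto. fold q.
  replace (w - w0)%C with (h * v)%C by (unfold w, w0; rewrite RtoC_plus; ring).
  assert (E : (Re (u * (psum a w0 + h * v * q w))%C - Re (u * psum a w0)%C) / h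
     - Re (u * (v * q w0))%C = Re (u * v * (q w - q w0))%C).
  { assert (E1 : (Re (u * (psum a w0 + h * v * q w))%C - Re (u * psum a w0)%C) = h * Re (u * v * q w)%C).
    { unfold Re, Cmult, Cplus, RtoC; simpl; ring. }
    rewrite E1. replace (h * Re (u * v * q w)%C / h) with (Re (u * v * q w)%C) by (field; auto).
    unfold Re, Cmult, Cminus, Cplus, Copp; simpl; ring. }
  rewrite E. eapply Rle_lt_trans. apply re_le_Cmod. rewrite !Cmod_mult.
  apply Rle_lt_trans with (K * Cmod (q w - q w0)%C).
  apply Rmult_le_compat_r. apply Cmod_ge_0. unfold K; lra.
  apply (Rmult_lt_compat_l K) in H1; auto.
  replace (K * (eps / K)) with eps in H1 by (field; lra). auto.
Qed.

Lemma Re_conj_mult_self (c : C) : Re (Cconj c * c)%C = Cmod c * Cmod c.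
Proof.
  replace (Cmod c * Cmod c) with (Cmod c ^ 2) by ring. rewrite Cmod2_alt.
  destruct c; unfold Re, Im, Cconj, Cmult; simpl; ring.
Qed.

(** Along the path, the component of [psum a] in the direction of the total
    increment grows no faster than [G]. *)
Lemma path_increment a (z v : C) (G G' : R -> R) s0 s1 :
  summable a -> s0 <= s1 ->
  (forall s, s0 <= s <= s1 -> Cmod (z + s * v)%C < 1) ->
  (forall s, s0 <= s <= s1 -> is_derive G s (G' s)) ->
  (forall s, s0 <= s <= s1 -> Cmod (v * psum (derived a) (z + s * v))%C <= G' s) ->
  Cmod (psum a (z + s1 * v) - psum a (z + s0 * v))%C <= G s1 - G s0.
Proof.
  intros Ha Hs Hin HG Hb.
  set (D := (psum a (z + s1 * v) - psum a (z + s0 * v))%C).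
  assert (HGm : G s0 <= G s1).
  { assert (H := nonincreasing_of_derive (fun s => - G s) (fun s => - G' s) s0 s1 Hs).
    assert (- G s1 <= - G s0); [|lra]. apply H.
    - intros s Hss. apply (is_derive_opp G). auto.
    - intros s Hss. assert (X := Cmod_ge_0 (v * psum (derived a) (z + s * v))%C).
      specialize (Hb s Hss). lra. }
  assert (HD := Cmod_ge_0 D).
  assert (H : Re (Cconj D * psum a (z + s1 * v))%C - Cmod D * G s1
           <= Re (Cconj D * psum a (z + s0 * v))%C - Cmod D * G s0).
  { apply (nonincreasing_of_derive (fun s => Re (Cconj D * psum a (z + s * v))%C - Cmod D * G s)
      (fun s => Re (Cconj D * (v * psum (derived a) (z + s * v)))%C - Cmod D * G' s)); auto.
    - intros s Hss. apply (is_derive_minus (fun s : R => Re (Cconj D * psum a (z + s * v))%C) (fun s => Cmod D * G s)).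
      apply psum_path_derive; auto.
      apply (is_derive_scal G). auto.
    - intros s Hss. specialize (Hb s Hss).
      assert (X := re_le_Cmod (Cconj D * (v * psum (derived a) (z + s * v)))%C).
      apply Rabs_le_between in X. rewrite Cmod_mult, Cmod_conj in X.
      assert (Cmod D * Cmod (v * psum (derived a) (z + s * v))%C <= Cmod D * G' s)
        by (apply Rmult_le_compat_l; auto). lra. }
  assert (E : Re (Cconj D * psum a (z + s1 * v))%C - Re (Cconj D * psum a (z + s0 * v))%C = Cmod D * Cmod D).
  { rewrite <- Re_conj_mult_self. unfold D at 4.
    unfold Re, Cmult, Cminus, Cplus, Copp; simpl; ring. }
  nra.
Qed.

Lemma segment_in_disk (z v : C) s r :
  0 <= s <= 1 -> Cmod z <= r -> Cmod (z + v)%C <= r -> Cmod (z + s * v)%C <= r.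
Proof.
  intros Hs Hz Hv.
  replace (z + s * v)%C with ((1 - s)%R * z + s * (z + v))%C by (rewrite RtoC_minus; ring).
  eapply Rle_trans. apply Cmod_triangle. rewrite !Cmod_mult, !Cmod_R, !Rabs_pos_eq by lra. nra.
Qed.

Lemma segment_increment a (z w : C) K :
  summable a -> Cmod z < 1 -> Cmod w < 1 ->
  (forall s, 0 <= s <= 1 -> Cmod (psum (derived a) (z + s * (w - z)))%C <= K) ->
  Cmod (psum a w - psum a z)%C <= K * Cmod (w - z)%C.
Proof.
  intros Ha Hz Hw Hb.
  assert (H := path_increment a z (w - z)%C (fun s => s * (K * Cmod (w - z)%C)) (fun s => K * Cmod (w - z)%C) 0 1 Ha).
  replace (z + 1 * (w - z))%C with w in H by ring.
  replace (z + 0 * (w - z))%C with z in H by ring.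
  replace (1 * (K * Cmod (w - z)%C) - 0 * (K * Cmod (w - z)%C)) with (K * Cmod (w - z)%C) in H by ring.
  apply H.
  - lra.
  - intros s Hs. apply Rle_lt_trans with (Rmax (Cmod z) (Cmod w)).
    apply segment_in_disk; auto. apply Rmax_l.
    replace (z + (w - z))%C with w by ring. apply Rmax_r. now apply Rmax_lub_lt.
  - intros s Hs. auto_derive; auto. ring.
  - intros s Hs. rewrite Cmod_mult, Rmult_comm. apply Rmult_le_compat_r; auto. apply Cmod_ge_0.
Qed.

(** Used to let the radius of a disc on which the maximum principle is applied
    tend to 1. *)
Lemma le_of_radii x a b :
  0 <= x < 1 -> 0 <= a -> (forall rho, x < rho < 1 -> a * rho <= b) -> a <= b.
Proof.
  intros Hx Ha H. apply Rnot_lt_le. intros Hlt.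
  assert (Hb : 0 <= b).
  { apply Rle_trans with (2 := H ((1 + x) / 2) ltac:(lra)). apply Rmult_le_pos; lra. }
  assert (Hba : b / a < 1).
  { apply (Rmult_lt_reg_r a). lra. unfold Rdiv. rewrite Rmult_assoc, Rinv_l; lra. }
  set (m := Rmax x (b / a)). assert (m < 1) by (apply Rmax_lub_lt; lra).
  assert (x <= m) by apply Rmax_l. assert (b / a <= m) by apply Rmax_r.
  specialize (H ((1 + m) / 2) ltac:(lra)).
  assert (b = a * (b / a)) by (field; lra). nra.
Qed.

Lemma near_neq (z c : C) : z <> c -> near z (fun w => w <> c).
Proof.
  intros H. exists (Cmod (z - c)%C). split.
  apply Cmod_gt_0. intros E. apply H. replace z with ((z - c) + c)%C by ring. rewrite E. ring.
  intros w Hw E. subst w. replace (c - z)%C with (- (z - c))%C in Hw by ring.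
  rewrite Cmod_opp in Hw. lra.
Qed.

Lemma Ceq_dec (x y : C) : {x = y} + {x <> y}.
Proof.
  destruct x as [x1 x2], y as [y1 y2].
  destruct (Req_EM_T x1 y1) as [->|H1].
  - destruct (Req_EM_T x2 y2) as [->|H2]. now left. right. intros E. now injection E.
  - right. intros E. now injection E.
Qed.

(** The maximum principle is applied to [h z / z], whose expansions lose one
    order at 0; hence the order 3 in the hypothesis. *)
Theorem schwarz (h : C -> C) :
  (forall z, Cmod z < 1 -> taylor 3 h z) -> h 0%C = 0%C ->
  (forall z, Cmod z < 1 -> Cmod (h z) <= 1) ->
  forall z, Cmod z < 1 -> Cmod (h z) <= Cmod z.
Proof.
  intros Ht H0 Hb z Hz.
  assert (H00 : Cmod 0%C < 1) by (rewrite Cmod_0; lra).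
  destruct (Ht 0%C H00) as (h1 & Hh1 & Th1).
  set (k := fun w => if Ceq_dec w 0 then h1 0%C else (h w / w)%C).
  assert (Hk : forall w : C, w <> 0%C -> k w = (h w / w)%C).
  { intros w Hw. unfold k. destruct (Ceq_dec w 0); [contradiction|reflexivity]. }
  assert (Tk : forall w, Cmod w < 1 -> taylor 2 k w).
  { intros w Hw. destruct (Ceq_dec w 0) as [->|Hw0].
    - apply taylor_ext with (2 := Th1). apply near_imp with (2 := Hh1).
      intros v Hv. unfold k. destruct (Ceq_dec v 0) as [->|Hv0]; auto.
      rewrite Hv, H0. field. auto.
    - apply taylor_ext with (fun w => h w / w)%C.
      apply near_imp with (2 := near_neq _ _ Hw0). intros v Hv. now rewrite Hk.
      apply taylor_div; auto. apply (taylor_le 2 3); auto. apply taylor_id. }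
  destruct (Ceq_dec z 0) as [->|Hz0]. rewrite H0; lra.
  assert (Hzp : 0 < Cmod z) by now apply Cmod_gt_0.
  apply le_of_radii with (Cmod z). split; auto; lra. apply Cmod_ge_0.
  intros rho Hrho.
  assert (M : Cmod (k z) <= / rho).
  { apply (maximum_modulus 0%C rho (/ rho) k).
    - lra.
    - intros w Hw. replace (w - 0)%C with w in Hw by ring. apply (taylor_cont 2), Tk. lra.
    - intros w Hw. replace (w - 0)%C with w in Hw by ring. apply Tk. lra.
    - intros w Hw. replace (w - 0)%C with w in Hw by ring.
      assert (w <> 0%C) by (apply Cmod_gt_0; lra).
      rewrite Hk, Cmod_div, Hw by auto. unfold Rdiv. rewrite <- (Rmult_1_l (/ rho)) at 2.
      apply Rmult_le_compat_r. left; apply Rinv_0_lt_compat; lra. apply Hb; lra.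
    - replace (z - 0)%C with z by ring. lra. }
  rewrite Hk, Cmod_div in M by auto.
  apply (Rmult_le_compat_r (rho * Cmod z)) in M. 2: nra.
  replace (Cmod (h z) / Cmod z * (rho * Cmod z)) with (Cmod (h z) * rho) in M by (field; lra).
  replace (/ rho * (rho * Cmod z)) with (Cmod z) in M by (field; lra). lra.
Qed.

(** * Univalent and convex functions *)

Lemma psum_cont a z : summable a -> Cmod z < 1 -> cont (psum a) z.
Proof. apply (psum_taylor 0). Qed.

Lemma disc_in_disk z0 z s : Cmod (z - z0)%C <= s -> Cmod z0 + s < 1 -> Cmod z < 1.
Proof. intros H1 H2. apply Cmod_center_bound in H1. lra. Qed.

Lemma circle_gap a z0 s :
  summable a -> injective_on unit_disk (psum a) -> 0 < s -> Cmod z0 + s < 1 ->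
  exists m, 0 < m /\
    forall z, Cmod (z - z0)%C = s -> m <= Cmod (psum a z - psum a z0)%C.
Proof.
  intros Ha Hinj Hs Hz.
  apply (circle_min z0 s (fun z => psum a z - psum a z0)%C).
  - lra.
  - intros z Hzs. apply cont_minus. apply psum_cont; auto.
    apply disc_in_disk with z0 s; auto. lra. apply cont_const.
  - intros z Hzs E.
    assert (z = z0).
    { apply Hinj. apply disc_in_disk with z0 s; auto. lra. red. lra.
      replace (psum a z) with (psum a z - psum a z0 + psum a z0)%C by ring.
      rewrite E. ring. }
    subst z. rewrite Cmod_refl in Hzs. lra.
Qed.

(** By [zero_in_disc] every value close to [psum a z0] is attained near [z0],
    and by injectivity it is attained nowhere else. *)
Lemma inverse_cont a z0 e :
  summable a -> injective_on unit_disk (psum a) -> Cmod z0 < 1 -> 0 < e ->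
  exists d, 0 < d /\ forall z, Cmod z < 1 ->
    Cmod (psum a z - psum a z0)%C < d -> Cmod (z - z0)%C < e.
Proof.
  intros Ha Hinj Hz0 He.
  set (s := Rmin (e / 2) ((1 - Cmod z0) / 2)).
  assert (Hs : 0 < s) by (apply Rmin_glb_lt; lra).
  assert (Hs1 : s < e). { apply Rle_lt_trans with (e / 2). apply Rmin_l. lra. }
  assert (Hs2 : Cmod z0 + s < 1).
  { assert (s <= (1 - Cmod z0) / 2) by apply Rmin_r. lra. }
  destruct (circle_gap a z0 s Ha Hinj Hs Hs2) as (m & Hm & Hgap).
  exists (m / 2). split. lra. intros z Hz Hfz.
  destruct (zero_in_disc z0 s (m / 2) (fun w => psum a w - psum a z)%C) as (w & Hw1 & Hw2).
  - lra.
  - intros w Hw. apply taylor_minus. apply psum_taylor; auto.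
    apply disc_in_disk with z0 s; auto. apply taylor_const.
  - intros w Hw. specialize (Hgap w Hw).
    assert (T := Cmod_triangle (psum a w - psum a z)%C (psum a z - psum a z0)%C).
    replace (psum a w - psum a z + (psum a z - psum a z0))%C
      with (psum a w - psum a z0)%C in T by ring. lra.
  - replace (psum a z0 - psum a z)%C with (- (psum a z - psum a z0))%C by ring.
    now rewrite Cmod_opp.
  - assert (w = z).
    { apply Hinj; auto. apply disc_in_disk with z0 s; auto. lra.
      replace (psum a w) with (psum a w - psum a z + psum a z)%C by ring. rewrite Hw2. ring. }
    subst w. lra.
Qed.

(** If the derivative vanished on a whole neighbourhood, the function would be
    constant there and not injective. *)
Lemma nonvanishing_derivative_near a z0 d :
  summable a -> injective_on unit_disk (psum a) -> Cmod z0 < 1 -> 0 < d ->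
  exists z1, 0 < Cmod (z1 - z0)%C < d /\ Cmod z1 < 1 /\ psum (derived a) z1 <> 0%C.
Proof.
  intros Ha Hinj Hz0 Hd.
  destruct (Ceq_dec (psum (derived a) z0) 0%C) as [E0|Hne].
  - apply NNPP. intros Hno.
    set (s := Rmin (d / 2) ((1 - Cmod z0) / 2)).
    assert (Hs : 0 < s) by (apply Rmin_glb_lt; lra).
    assert (Hs1 : s < d). { apply Rle_lt_trans with (d / 2). apply Rmin_l. lra. }
    assert (Hs2 : Cmod z0 + s < 1).
    { assert (s <= (1 - Cmod z0) / 2) by apply Rmin_r. lra. }
    assert (Hall : forall z, Cmod (z - z0)%C <= s -> psum (derived a) z = 0%C).
    { intros z Hz. destruct (Ceq_dec z z0) as [->|Hzz]; auto.
      apply NNPP. intros Hn. apply Hno. exists z. split; [split|split]; auto; try lra.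
      - apply Cmod_gt_0. intros E. apply Hzz. replace z with (z - z0 + z0)%C by ring. rewrite E; ring.
      - apply disc_in_disk with z0 s; auto. }
    assert (Hes : Cmod (z0 + s - z0)%C = s).
    { replace (z0 + s - z0)%C with (RtoC s) by ring. rewrite Cmod_R. apply Rabs_pos_eq; lra. }
    assert (Hin : Cmod (z0 + s)%C < 1) by (apply disc_in_disk with z0 s; auto; lra).
    assert (H := segment_increment a z0 (z0 + s)%C 0 Ha Hz0 Hin).
    rewrite Rmult_0_l in H.
    assert (Cmod (psum a (z0 + s) - psum a z0)%C = 0).
    { apply Rle_antisym. 2: apply Cmod_ge_0. apply H. intros x Hx.
      rewrite Hall. rewrite Cmod_0; lra.
      replace (z0 + x * (z0 + s - z0) - z0)%C with (RtoC (x * s)) by (rewrite RtoC_mult; ring).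
      rewrite Cmod_R, Rabs_pos_eq; nra. }
    apply Cmod_eq_0 in H0.
    assert ((z0 + s)%C = z0).
    { apply Hinj; auto. replace (psum a (z0 + s)) with (psum a (z0 + s) - psum a z0 + psum a z0)%C by ring.
      rewrite H0; ring. }
    rewrite H1, Cmod_refl in Hes. lra.
  - assert (Hc : cont (psum (derived a)) z0) by (apply psum_cont; auto; now apply derived_summable).
    apply Cmod_gt_0 in Hne.
    destruct (near_and _ _ _ (Hc _ Hne) (near_disk _ Hz0)) as (d1 & Hd1 & Hn).
    set (s := Rmin (d / 2) (d1 / 2)).
    assert (Hs : 0 < s) by (apply Rmin_glb_lt; lra).
    assert (Hs1 : s <= d / 2) by apply Rmin_l.
    assert (Hs2 : s <= d1 / 2) by apply Rmin_r.
    assert (Hes : Cmod (z0 + s - z0)%C = s).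
    { replace (z0 + s - z0)%C with (RtoC s) by ring. rewrite Cmod_R. apply Rabs_pos_eq; lra. }
    exists (z0 + s)%C. rewrite Hes. destruct (Hn (z0 + s)%C) as [H1 H2]. lra.
    split; [|split]; auto. lra. intros E. rewrite E in H1.
    replace (0 - psum (derived a) z0)%C with (- psum (derived a) z0)%C in H1 by ring.
    rewrite Cmod_opp in H1. lra.
Qed.

(** Hurwitz' argument.  If the derivative vanished at [z0], then for [z1] close to
    [z0] the difference quotient based at [z1] would be small at [z0] but bounded
    below on a fixed circle, so it would have a zero [w].  Injectivity forces
    [w = z1], where the quotient is the derivative, and [z1] can be chosen so that
    this is not zero. *)
Theorem univalent_derivative a z0 :
  summable a -> injective_on unit_disk (psum a) -> Cmod z0 < 1 ->
  psum (derived a) z0 <> 0%C.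
Proof.
  intros Ha Hinj Hz0 E0.
  set (s := (1 - Cmod z0) / 2).
  assert (Hs : 0 < s) by (unfold s; lra).
  assert (Hs2 : Cmod z0 + s < 1) by (unfold s; lra).
  destruct (circle_gap a z0 s Ha Hinj Hs Hs2) as (m & Hm & Hgap).
  assert (Hq0 : cont (psum (quotient z0 a)) z0).
  { apply psum_cont; auto. now apply quotient_summable. }
  assert (Hms : 0 < m / (4 * s)) by (apply Rdiv_lt_0_compat; lra).
  destruct (near_and _ _ _ (Hq0 _ Hms) (psum_cont a z0 Ha Hz0 (m / 2) ltac:(lra))) as (d & Hd & Hn).
  destruct (nonvanishing_derivative_near a z0 (Rmin d s) Ha Hinj Hz0) as (z1 & Hz1 & Hz1d & Hd1).
  { now apply Rmin_glb_lt. }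
  destruct (Hn z1) as [H1 H2]. { apply Rlt_le_trans with (2 := Rmin_l d s). apply Hz1. }
  assert (Hz1s : Cmod (z1 - z0)%C < s). { apply Rlt_le_trans with (2 := Rmin_r d s). apply Hz1. }
  rewrite <- psum_derived, E0 in H1 by auto.
  replace (psum (quotient z0 a) z1 - 0)%C with (psum (quotient z0 a) z1) in H1 by ring.
  set (Q := psum (quotient z1 a)).
  assert (HQ : forall z, Cmod z < 1 -> psum a z = (psum a z1 + (z - z1) * Q z)%C).
  { intros z Hz. now apply psum_quotient. }
  destruct (zero_in_disc z0 s (m / (4 * s)) Q) as (w & Hw1 & Hw2).
  - lra.
  - intros z Hz. apply psum_taylor. now apply quotient_summable. apply disc_in_disk with z0 s; auto.
  - intros z Hz. assert (Hzd : Cmod z < 1) by (apply disc_in_disk with z0 s; auto; lra).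
    specialize (Hgap z Hz).
    assert (T := Cmod_triangle (psum a z - psum a z1)%C (psum a z1 - psum a z0)%C).
    replace (psum a z - psum a z1 + (psum a z1 - psum a z0))%C
      with (psum a z - psum a z0)%C in T by ring.
    assert (T2 := Cmod_triangle (z - z0)%C (- (z1 - z0))%C).
    replace (z - z0 + - (z1 - z0))%C with (z - z1)%C in T2 by ring. rewrite Cmod_opp in T2.
    rewrite (HQ z Hzd) in T at 2. replace (psum a z1 + (z - z1) * Q z - psum a z1)%C with ((z - z1) * Q z)%C in T by ring.
    rewrite Cmod_mult in T.
    assert (X := Cmod_ge_0 (Q z)).
    assert (m / 2 <= 2 * s * Cmod (Q z)) by nra.
    apply (Rmult_le_reg_r (4 * s)). lra.
    replace (m / (4 * s) * (4 * s)) with m by (field; lra). lra.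
  (* the difference quotient is symmetric in its two points *)
  - assert (E1 := HQ z0 Hz0). assert (E2 := psum_quotient a z0 z1 Ha Hz0 Hz1d).
    assert (Hne : (z1 - z0)%C <> 0%C) by (apply Cmod_gt_0; lra).
    assert (E : Q z0 = psum (quotient z0 a) z1).
    { transitivity ((z1 - z0) * Q z0 / (z1 - z0))%C. field; auto.
      replace ((z1 - z0) * Q z0)%C with ((z1 - z0) * psum (quotient z0 a) z1)%C. field; auto.
      rewrite E1 in E2.
      replace ((z1 - z0) * psum (quotient z0 a) z1)%C with
       ((psum a z1 + (z0 - z1) * Q z0 + (z1 - z0) * psum (quotient z0 a) z1) - psum a z1 - (z0 - z1) * Q z0)%C by ring.
      rewrite <- E2. ring. }
    rewrite E. auto.
  - assert (Hwd : Cmod w < 1) by (apply disc_in_disk with z0 s; auto; lra).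
    destruct (Ceq_dec w z1) as [->|Hne].
    + apply Hd1. rewrite psum_derived; auto.
    + apply Hne. apply Hinj; auto. rewrite (HQ w Hwd), Hw2. ring.
Qed.

(** Convexity puts the average in the range of the injective function, so
    [w = f^-1 (average)] defines a self-map of the disk that fixes 0; it is smooth
    by [taylor_implicit], and the bound is the Schwarz lemma. *)
Lemma rotation_average a (lambda mu : C) z :
  summable a -> injective_on unit_disk (psum a) -> convex_set (image_of unit_disk (psum a)) ->
  Cmod lambda = 1 -> Cmod mu = 1 -> Cmod z < 1 ->
  exists w, Cmod w <= Cmod z /\
    psum a w = ((psum a (lambda * z) + psum a (mu * z)) / 2)%C.
Proof.
  intros Ha Hinj Hconv Hl Hm Hz.
  assert (rot : forall l x : C, Cmod l = 1 -> Cmod x < 1 -> Cmod (l * x)%C < 1).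
  { intros l x H1 H2. rewrite Cmod_mult, H1. lra. }
  set (g := fun x => ((psum a (lambda * x) + psum a (mu * x)) / 2)%C).
  assert (ex : forall x, exists w, Cmod x < 1 -> Cmod w < 1 /\ psum a w = g x).
  { intros x. destruct (Rlt_dec (Cmod x) 1) as [Hx|Hx].
    2: exists 0%C; intros; contradiction.
    destruct (Hconv (psum a (lambda * x)) (psum a (mu * x)) (1 / 2)) as (w & Hw & E).
    - exists (lambda * x)%C. split; auto. now apply rot.
    - exists (mu * x)%C. split; auto. now apply rot.
    - lra.
    - exists w. intros _. split; auto. rewrite E. unfold g.
      rewrite RtoC_minus, RtoC_div by lra. field. }
  destruct (functional_choice _ ex) as [h Hh].
  assert (H00 : Cmod 0%C < 1) by (rewrite Cmod_0; lra).
  assert (Tg : forall x, Cmod x < 1 -> taylor 3 g x).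
  { intros x Hx. apply taylor_div. 2: apply taylor_const.
    2: { intros E. apply RtoC_inj in E. lra. }
    apply taylor_plus.
    - apply (taylor_comp 3 (fun y => lambda * y)%C). apply taylor_mult. apply taylor_const. apply taylor_id.
      apply psum_taylor; auto.
    - apply (taylor_comp 3 (fun y => mu * y)%C). apply taylor_mult. apply taylor_const. apply taylor_id.
      apply psum_taylor; auto. }
  exists (h z). split. 2: now apply Hh.
  apply schwarz; auto.
  - intros x Hx. destruct (Hh x Hx) as [H1 H2].
    apply taylor_implicit with (psum a) g (psum (quotient (h x) a)).
    + intros e He.
      destruct (inverse_cont a (h x) e Ha Hinj H1 He) as (d & Hd & Hinv).
      apply near_imp with (2 := near_and _ _ _ (near_disk _ Hx) (taylor_cont _ _ _ (Tg x Hx) d Hd)).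
      intros y [Hy1 Hy2]. destruct (Hh y Hy1) as [H3 H4]. apply Hinv; auto. rewrite H2, H4. auto.
    + apply near_imp with (2 := near_disk _ Hx). intros y Hy. now apply Hh.
    + auto.
    + apply near_imp with (2 := near_disk _ H1). intros y Hy. now apply psum_quotient.
    + rewrite <- psum_derived by auto. now apply univalent_derivative.
    + apply psum_taylor; auto. now apply quotient_summable.
  - destruct (Hh 0%C H00) as [H1 H2]. apply Hinj; auto.
    rewrite H2. unfold g. rewrite !Cmult_0_r. field. 
  - intros x Hx. destruct (Hh x Hx). lra.
Qed.

Lemma unit_modulus (s : R) : Cmod ((1 + Ci * s) / (1 - Ci * s))%C = 1.
Proof.
  assert (E : (1 + Ci * s)%C = Cconj (1 - Ci * s)%C).
  { unfold Cconj, Ci, RtoC, Cminus, Cplus, Cmult, Copp; simpl. f_equal; ring. }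
  assert (Hn : (1 - Ci * s)%C <> 0%C).
  { intros H. apply (f_equal Re) in H. unfold Re, Ci, RtoC, Cminus, Cplus, Cmult, Copp in H; simpl in H. lra. }
  rewrite Cmod_div, E, Cmod_conj by auto. field. now apply Rgt_not_eq, Cmod_gt_0.
Qed.

Lemma one_minus_is_neq_0 (s : R) : (1 - Ci * s)%C <> 0%C /\ (1 + Ci * s)%C <> 0%C.
Proof.
  split; intros H; apply (f_equal Re) in H;
  unfold Re, Ci, RtoC, Cminus, Cplus, Cmult, Copp in H; simpl in H; lra.
Qed.

(** Use the rotations [(1 + i s) / (1 - i s)] and its inverse with [s] real and
    small.  The average is [f z - 2 s^2 (z f' + z^2 f'') + o(s^2)], so the point
    [w] of [rotation_average] is [z - 2 s^2 z (1 + z f'' / f') + o(s^2)], and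
    [|w| <= |z|] leaves no room for a negative real part.  This rational
    parametrisation makes all expansions continuous functions of [s]. *)
Theorem convex_real_part a z :
  summable a -> injective_on unit_disk (psum a) -> convex_set (image_of unit_disk (psum a)) ->
  Cmod z < 1 ->
  0 <= Re (1 + z * psum (derived (derived a)) z / psum (derived a) z)%C.
Proof.
  intros Ha Hinj Hconv Hz.
  assert (HB := univalent_derivative a z Ha Hinj Hz).
  rewrite psum_derived2 by auto. set (B := psum (derived a) z) in *.
  set (f1 := psum (quotient z a)). set (f2 := psum (quotient z (quotient z a))).
  assert (Hqs := quotient_summable z a Ha Hz).
  assert (Hf1z : f1 z = B) by (symmetry; now apply psum_derived).
  assert (E1 : forall w, Cmod w < 1 -> psum a w = (psum a z + (w - z) * f1 w)%C).
  { intros w Hw. now apply psum_quotient. }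
  assert (E2 : forall w, Cmod w < 1 -> f1 w = (B + (w - z) * f2 w)%C).
  { intros w Hw. rewrite <- Hf1z. now apply psum_quotient. }
  assert (Cf1 : cont f1 z) by now apply psum_cont.
  assert (Cf2 : cont f2 z) by (apply psum_cont; auto; now apply quotient_summable).
  apply Rnot_lt_le. intros Hneg.
  assert (Hz0 : z <> 0%C).
  { intros E. assert (E0 : (1 + z * (2 * f2 z) / B)%C = RtoC 1).
    { set (y := f2 z). rewrite E. field. auto. }
    fold f2 in Hneg. rewrite E0 in Hneg. simpl in Hneg. lra. }
  (* [lp] and [lm] are inverse rotations for real [s]; [W] is [s^-2] times the
     average of [psum a] over them minus [psum a z], and is continuous at [s = 0] *)
  set (lp := fun s : C => ((1 + Ci * s) / (1 - Ci * s))%C).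
  set (lm := fun s : C => ((1 - Ci * s) / (1 + Ci * s))%C).
  set (W := fun s : C => (- (2 * B * z / ((1 - Ci * s) * (1 + Ci * s)))
     - 2 * z * z * (f2 (lp s * z) / ((1 - Ci * s) * (1 - Ci * s))
                    + f2 (lm s * z) / ((1 + Ci * s) * (1 + Ci * s))))%C).
  assert (C1m : cont (fun s => 1 - Ci * s)%C 0%C).
  { apply cont_minus. apply cont_const. apply cont_mult. apply cont_const. apply cont_id. }
  assert (C1p : cont (fun s => 1 + Ci * s)%C 0%C).
  { apply cont_plus. apply cont_const. apply cont_mult. apply cont_const. apply cont_id. }
  assert (N1m : (1 - Ci * 0)%C <> 0%C) by (apply (one_minus_is_neq_0 0)).
  assert (N1p : (1 + Ci * 0)%C <> 0%C) by (apply (one_minus_is_neq_0 0)).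
  assert (lp0 : (lp 0%C * z)%C = z) by (unfold lp; field; auto).
  assert (lm0 : (lm 0%C * z)%C = z) by (unfold lm; field; auto).
  assert (Clp : cont (fun s => lp s * z)%C 0%C).
  { apply cont_mult. apply cont_div; auto. apply cont_const. }
  assert (Clm : cont (fun s => lm s * z)%C 0%C).
  { apply cont_mult. apply cont_div; auto. apply cont_const. }
  assert (CW : cont W 0%C).
  { unfold W. apply cont_minus.
    - apply cont_opp. apply cont_div. apply cont_const. apply cont_mult; auto.
      now apply Cmult_neq_0.
    - apply cont_mult. apply cont_const. apply cont_plus.
      + apply cont_div. apply (cont_comp (fun s => lp s * z)%C); auto. now rewrite lp0.
        apply cont_mult; auto. now apply Cmult_neq_0.
      + apply cont_div. apply (cont_comp (fun s => lm s * z)%C); auto. now rewrite lm0.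
        apply cont_mult; auto. now apply Cmult_neq_0. }
  assert (W0 : W 0%C = (- (2 * z) * (B + z * (2 * f2 z)))%C).
  { unfold W. rewrite lp0, lm0. 
    replace (1 - Ci * 0)%C with (RtoC 1) by ring. replace (1 + Ci * 0)%C with (RtoC 1) by ring.
    field. }
  set (X0 := (Cconj z * W 0 * / f1 z)%C).
  assert (HX0 : 0 < Re X0).
  { assert (E : X0 = ((- 2 * (Cmod z * Cmod z))%R * (1 + z * (2 * f2 z) / B))%C).
    { unfold X0. rewrite W0, Hf1z, !RtoC_mult.
      replace (Cmod z * Cmod z)%C with (RtoC (Cmod z ^ 2)) by (simpl; rewrite !RtoC_mult; ring).
      rewrite Cmod2_conj. replace (RtoC (-2)) with (- (2))%C by (rewrite <- RtoC_opp; reflexivity).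
      field. auto. }
    rewrite E.
    assert (HzP : 0 < Cmod z) by now apply Cmod_gt_0.
    change (Re (1 + z * (2 * f2 z) / B)%C < 0) in Hneg.
    set (P := (1 + z * (2 * f2 z) / B)%C) in *.
    assert (HzP2 : 0 < Cmod z * Cmod z) by now apply Rmult_lt_0_compat.
    clearbody P. destruct P as [p1 p2]. simpl in *. nra. }
  destruct (Cmult_close (Cconj z * W 0)%C (/ f1 z)%C (Re X0) HX0) as (e & He & Hclose).
  assert (CcW : cont (fun s => Cconj z * W s)%C 0%C) by (apply cont_mult; auto; apply cont_const).
  assert (Cinvf1 : cont (fun w => / f1 w)%C z) by (apply cont_inv; auto; now rewrite Hf1z).
  destruct (near_and _ _ _ (Cinvf1 e He) (Cf1 (Cmod B) ltac:(now apply Cmod_gt_0))) as (d1 & Hd1 & Hf1n).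
  destruct (inverse_cont a z d1 Ha Hinj Hz Hd1) as (d2 & Hd2 & Hinv).
  assert (Cavg : cont (fun s => (psum a (lp s * z) + psum a (lm s * z)) / 2)%C 0%C).
  { apply cont_div. 2: apply cont_const. apply cont_plus.
    apply (cont_comp (fun s => lp s * z)%C); auto. rewrite lp0. now apply psum_cont.
    apply (cont_comp (fun s => lm s * z)%C); auto. rewrite lm0. now apply psum_cont.
    intros E. apply RtoC_inj in E. lra. }
  destruct (near_and _ _ _ (CcW e He) (Cavg d2 Hd2)) as (d & Hd & Hn).
  set (s := d / 2). assert (Hs : 0 < s) by (unfold s; lra).
  destruct (Hn s) as [H1 H2].
  { replace (s - 0)%C with (RtoC s) by ring. rewrite Cmod_R, Rabs_pos_eq; unfold s; lra. }
  destruct (one_minus_is_neq_0 s) as [Nm Np].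
  assert (Ulp : Cmod (lp s) = 1) by apply unit_modulus.
  assert (Ulm : Cmod (lm s) = 1).
  { replace (lm s) with ((1 + Ci * (- s)%R) / (1 - Ci * (- s)%R))%C. apply unit_modulus.
    rewrite RtoC_opp. unfold lm.
    replace (1 + Ci * - s)%C with (1 - Ci * s)%C by ring.
    now replace (1 - Ci * - s)%C with (1 + Ci * s)%C by ring. }
  destruct (rotation_average a (lp s) (lm s) z Ha Hinj Hconv Ulp Ulm Hz) as (w & Hw & Ew).
  assert (Hw1 : Cmod w < 1) by lra.
  destruct (Hf1n w) as [H3 H4].
  { apply Hinv; auto. rewrite Ew. rewrite lp0, lm0 in H2.
    replace ((psum a z + psum a z) / 2)%C with (psum a z) in H2 by field. exact H2. }
  assert (Nf1 : f1 w <> 0%C).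
  { intros E. rewrite E, Hf1z in H4. replace (0 - B)%C with (- B)%C in H4 by ring. rewrite Cmod_opp in H4. lra. }
  assert (HlpD : Cmod (lp s * z)%C < 1) by (rewrite Cmod_mult, Ulp; lra).
  assert (HlmD : Cmod (lm s * z)%C < 1) by (rewrite Cmod_mult, Ulm; lra).
  assert (Ed : ((w - z) * f1 w = s * s * W s)%C).
  { assert (Ew' : (psum a w - psum a z = s * s * W s)%C).
    { rewrite Ew, (E1 _ HlpD), (E1 _ HlmD), (E2 _ HlpD), (E2 _ HlmD). unfold W.
      set (F2p := f2 (lp s * z)%C). set (F2m := f2 (lm s * z)%C).
      replace (lp s * z - z)%C with (2 * Ci * s * z / (1 - Ci * s))%C by (unfold lp; field; auto).
      replace (lm s * z - z)%C with (- (2 * Ci * s * z / (1 + Ci * s)))%C by (unfold lm; field; auto).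
      assert (Ci2 : (Ci * Ci)%C = (- (1))%C) by (unfold Ci, Cmult, Copp, RtoC; simpl; f_equal; ring).
      transitivity ((Ci * Ci) * (s * s * (2 * B * z / ((1 - Ci * s) * (1 + Ci * s))
         + 2 * z * z * (F2p / ((1 - Ci * s) * (1 - Ci * s)) + F2m / ((1 + Ci * s) * (1 + Ci * s))))))%C.
      - field. auto.
      - rewrite Ci2. ring. }
    rewrite <- Ew', (E1 w Hw1). ring. }
  specialize (Hclose _ _ H1 H3). fold X0 in Hclose.
  assert (Hpos : 0 < Re (Cconj z * W s * / f1 w)%C).
  { assert (X := re_le_Cmod (Cconj z * W s * / f1 w - X0)%C). apply Rabs_le_between in X.
    assert (Re (Cconj z * W s * / f1 w - X0)%C = Re (Cconj z * W s * / f1 w)%C - Re X0)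
      by (unfold Re, Cminus, Cplus, Copp; simpl; ring).
    lra. }
  assert (Ez : (Cconj z * (w - z))%C = ((s * s)%R * (Cconj z * W s * / f1 w))%C).
  { rewrite RtoC_mult. transitivity (Cconj z * ((w - z) * f1 w) / f1 w)%C. field; auto.
    rewrite Ed. field; auto. }
  assert (Hre : 0 < Re (Cconj z * (w - z))%C).
  { rewrite Ez. revert Hpos. generalize (Cconj z * W s * / f1 w)%C. intros [y1 y2].
    simpl. intros Hy1. assert (0 < s * s * y1); [|lra].
    apply Rmult_lt_0_compat; auto. now apply Rmult_lt_0_compat. }
  assert (Hcontr : Cmod w * Cmod w <= Cmod z * Cmod z).
  { assert (X := Cmod_ge_0 w). nra. }
  rewrite <- !normsq_Cmod in Hcontr. destruct w as [w1 w2], z as [z1 z2].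
  unfold normsq, Re, Im, Cconj, Cmult, Cminus, Cplus, Copp in Hre, Hcontr. simpl in Hre, Hcontr.
  assert (0 <= (w1 - z1) * (w1 - z1)) by apply Rle_0_sqr.
  assert (0 <= (w2 - z2) * (w2 - z2)) by apply Rle_0_sqr.
  lra.
Qed.

(** * The Schwarz function of a convex map *)

Lemma Cmod_cayley_le p : p <> (- (1))%C -> 0 <= Re p -> Cmod ((p - 1) / (p + 1))%C <= 1.
Proof.
  intros Hp Hre.
  assert (Hn : (p + 1)%C <> 0%C).
  { intros E. apply Hp. replace p with (p + 1 - 1)%C by ring. rewrite E. ring. }
  assert (Hpos := proj1 (Cmod_gt_0 _) Hn).
  rewrite Cmod_div by auto. apply (Rmult_le_reg_r (Cmod (p + 1)%C)); auto.
  unfold Rdiv. rewrite Rmult_assoc, Rinv_l, Rmult_1_l, Rmult_1_r by lra.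
  apply Rsqr_incr_0_var. 2: lra. unfold Rsqr. rewrite <- !normsq_Cmod.
  destruct p as [x y]. unfold normsq. simpl in *. lra.
Qed.

(** With [p = 1 + z f'' / f'], the Cayley transform [(p - 1) / (p + 1)] is
    bounded by 1.  Since [f'' = z u] (this uses [a_2 = 0]), it equals
    [z^2 psi] for [psi = u / (2 f' + z^2 u)], and the maximum principle removes
    the factor [z^2] from the bound. *)
Theorem convex_schwarz_function a :
  summable a -> injective_on unit_disk (psum a) -> convex_set (image_of unit_disk (psum a)) ->
  a 1%nat = 1%C -> a 2%nat = 0%C ->
  exists psi : C -> C,
    (forall z, Cmod z < 1 -> taylor 3 psi z) /\
    (forall z, Cmod z < 1 -> Cmod (psi z) <= 1) /\
    psi 0%C = (3 * a 3%nat)%C /\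
    (forall z, Cmod z < 1 ->
       psum (derived (derived a)) z * (1 - z * z * psi z) = 2 * z * psi z * psum (derived a) z)%C.
Proof.
  intros Ha Hinj Hconv H1 H2.
  set (fp := psum (derived a)). set (fpp := psum (derived (derived a))).
  assert (Hd := derived_summable a Ha). assert (Hdd := derived_summable _ Hd).
  set (b := shift 1 (derived (derived a))). assert (Hb : summable b) by now apply shift_summable.
  set (u := psum b).
  assert (Hu : forall z, Cmod z < 1 -> fpp z = (z * u z)%C).
  { intros z Hz. unfold fpp, u. rewrite psum_shift by auto. unfold derived at 1 2. rewrite H2.
    fold b. ring. }
  assert (Hfp : forall z, Cmod z < 1 -> fp z <> 0%C) by (intros; now apply univalent_derivative).
  set (den := fun z => (2 * fp z + z * z * u z)%C).
  set (p := fun z => (1 + z * fpp z / fp z)%C).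
  assert (Hp : forall z, Cmod z < 1 -> 0 <= Re (p z)) by (intros; now apply convex_real_part).
  assert (Hp1 : forall z, Cmod z < 1 -> (p z + 1)%C <> 0%C).
  { intros z Hz E. assert (X := Hp z Hz). apply (f_equal Re) in E.
    change (Re (p z) + 1 = 0) in E. lra. }
  assert (Eden : forall z, Cmod z < 1 -> den z = (fp z * (p z + 1))%C).
  { intros z Hz. unfold den, p. rewrite Hu by auto. field. auto. }
  assert (Hden : forall z, Cmod z < 1 -> den z <> 0%C).
  { intros z Hz. rewrite Eden by auto. apply Cmult_neq_0; auto. }
  assert (T : forall z, Cmod z < 1 -> taylor 3 (fun z => u z / den z)%C z).
  { intros z Hz. apply taylor_div; auto. now apply psum_taylor.
    apply taylor_plus.
    - apply taylor_mult. apply taylor_const. now apply psum_taylor.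
    - apply taylor_mult. apply taylor_mult; apply taylor_id. now apply psum_taylor. }
  assert (Hw : forall z, Cmod z < 1 -> Cmod (z * z * (u z / den z))%C <= 1).
  { intros z Hz.
    replace (z * z * (u z / den z))%C with ((p z - 1) / (p z + 1))%C.
    - apply Cmod_cayley_le; auto. intros E. apply (Hp1 z Hz). rewrite E. ring.
    - rewrite Eden by auto. unfold p at 1. rewrite Hu by auto. field. split; auto. }
  exists (fun z => u z / den z)%C. split; [|split; [|split]]; auto.
  - intros z Hz. apply le_of_radii with (Cmod z). split; auto. apply Cmod_ge_0. apply Cmod_ge_0.
    (* on the circle of radius [sqrt rho] the bound for [z^2 psi] gives the bound [1 / rho] for [psi] *)
    intros rho Hrho. assert (Hz0 := Cmod_ge_0 z).
    set (s := sqrt rho).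
    assert (Hs : 0 < s) by (apply sqrt_lt_R0; lra).
    assert (Hss : s * s = rho) by (apply sqrt_sqrt; lra).
    assert (Hs1 : s < 1) by nra.
    assert (Hzs : Cmod z <= s) by nra.
    assert (M : Cmod (u z / den z)%C <= / rho).
    { apply (maximum_modulus 0%C s (/ rho) (fun z => u z / den z)%C).
      - lra.
      - intros w Hw'. replace (w - 0)%C with w in Hw' by ring. apply (taylor_cont 3), T. lra.
      - intros w Hw'. replace (w - 0)%C with w in Hw' by ring. apply (taylor_le 2 3); auto. apply T. lra.
      - intros w Hw'. replace (w - 0)%C with w in Hw' by ring.
        assert (X := Hw w ltac:(lra)). rewrite !Cmod_mult, Hw', Hss in X.
        apply (Rmult_le_reg_l rho). lra. rewrite Rinv_r by lra. exact X.
      - now replace (z - 0)%C with z by ring. }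
    apply (Rmult_le_compat_r rho) in M. rewrite Rinv_l in M by lra. exact M. lra.
  - unfold den, fp, u. rewrite !psum_0 by auto. unfold b, shift, derived. simpl.
    rewrite H1, RtoC_plus. 
    replace (RtoC 2 * 1)%C with (RtoC 2) by ring.
    replace (RtoC (1 + 1 + 1)) with (1 + 1 + 1)%C by (now rewrite !RtoC_plus).
    field.
  - intros z Hz. rewrite Hu by auto.
    transitivity (2 * z * u z * fp z / den z)%C.
    + unfold den at 1 2. field. apply Hden; auto.
    + field. apply Hden; auto.
Qed.

Lemma pick_inequality (x y : C) :
  Cmod x <= 1 -> Cmod y <= 1 -> Cmod (x - y)%C <= Cmod (1 - Cconj y * x)%C.
Proof.
  intros Hx Hy. apply Rsqr_incr_0_var. 2: apply Cmod_ge_0. unfold Rsqr.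
  assert (Hx2 : normsq x <= 1) by (rewrite normsq_Cmod; assert (X := Cmod_ge_0 x); nra).
  assert (Hy2 : normsq y <= 1) by (rewrite normsq_Cmod; assert (X := Cmod_ge_0 y); nra).
  rewrite <- !normsq_Cmod.
  assert (E : normsq (1 - Cconj y * x)%C - normsq (x - y)%C = (1 - normsq x) * (1 - normsq y)).
  { destruct x, y. unfold normsq. simpl. ring. }
  assert (0 <= (1 - normsq x) * (1 - normsq y)) by (apply Rmult_le_pos; lra). lra.
Qed.

(** The Schwarz lemma applied to the Moebius transform of [s psi] that sends
    [s psi 0] to 0, followed by [s -> 1].  The factor [s < 1] keeps the denominator
    away from 0, so the inequality includes the case [|psi 0| = 1], where it forces
    [psi] to be constant. *)
Theorem schwarz_pick (psi : C -> C) :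
  (forall z, Cmod z < 1 -> taylor 3 psi z) ->
  (forall z, Cmod z < 1 -> Cmod (psi z) <= 1) ->
  forall z, Cmod z < 1 ->
    Cmod (psi z - psi 0)%C <= Cmod z * Cmod (1 - Cconj (psi 0) * psi z)%C.
Proof.
  intros T Hb z Hz. set (y := psi 0%C).
  assert (Hy : Cmod y <= 1) by (apply Hb; rewrite Cmod_0; lra).
  assert (Hs : forall s : R, 0 < s < 1 ->
     s * Cmod (psi z - y)%C <= Cmod z * Cmod (1 - Cconj (s * y) * (s * psi z))%C).
  { intros s Hs.
    assert (Hsx : forall x, Cmod x <= 1 -> Cmod (s * x)%C < 1).
    { intros x Hx. rewrite Cmod_mult, Cmod_R, Rabs_pos_eq by lra. assert (X := Cmod_ge_0 x). nra. }
    assert (Hden : forall x, Cmod x <= 1 -> (1 - Cconj (s * y) * (s * x))%C <> 0%C).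
    { intros x Hx E.
      assert (E1 : (Cconj (s * y) * (s * x))%C = RtoC 1).
      { transitivity (1 - (1 - Cconj (s * y) * (s * x)))%C. ring. rewrite E. ring. }
      apply (f_equal Cmod) in E1. rewrite Cmod_mult, Cmod_conj, Cmod_1 in E1.
      assert (X1 := Hsx x Hx). assert (X2 := Hsx y Hy).
      assert (X3 := Cmod_ge_0 (s * x)%C). nra. }
    set (k := fun w => ((s * psi w - s * y) / (1 - Cconj (s * y) * (s * psi w)))%C).
    assert (Hk : Cmod (k z) <= Cmod z).
    { apply schwarz; auto.
      - intros w Hw. apply taylor_div; auto.
        + apply taylor_minus. apply taylor_mult; auto. apply taylor_const. apply taylor_const.
        + apply taylor_minus. apply taylor_const. apply taylor_mult. apply taylor_const.
          apply taylor_mult; auto. apply taylor_const.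
      - unfold k. fold y. replace (s * y - s * y)%C with (RtoC 0) by ring. unfold Cdiv. ring.
      - intros w Hw. unfold k. rewrite Cmod_div by auto.
        assert (X := proj1 (Cmod_gt_0 _) (Hden _ (Hb w Hw))).
        apply (Rmult_le_reg_r (Cmod (1 - Cconj (s * y) * (s * psi w))%C)); auto.
        unfold Rdiv. rewrite Rmult_assoc, Rinv_l, Rmult_1_l, Rmult_1_r by lra.
        apply pick_inequality; left; auto. }
    unfold k in Hk. rewrite Cmod_div in Hk by auto.
    assert (X := proj1 (Cmod_gt_0 _) (Hden _ (Hb z Hz))).
    apply (Rmult_le_compat_r (Cmod (1 - Cconj (s * y) * (s * psi z))%C)) in Hk. 2: lra.
    unfold Rdiv in Hk. rewrite Rmult_assoc, Rinv_l, Rmult_1_r in Hk by lra.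
    replace (s * psi z - s * y)%C with (s * (psi z - y))%C in Hk by ring.
    now rewrite Cmod_mult, Cmod_R, Rabs_pos_eq in Hk by lra. }
  set (A := Cmod (psi z - y)%C) in *. set (B := Cmod (1 - Cconj y * psi z)%C) in *.
  assert (HA : 0 <= A) by apply Cmod_ge_0. assert (HB : 0 <= B) by apply Cmod_ge_0.
  assert (Hz0 := Cmod_ge_0 z).
  assert (Hlim : forall s, 0 < s < 1 -> s * A <= Cmod z * B + (1 - s * s)).
  { intros s Hs'. eapply Rle_trans. apply Hs; auto.
    assert (Cmod (1 - Cconj (s * y) * (s * psi z))%C <= B + (1 - s * s)).
    { replace (1 - Cconj (s * y) * (s * psi z))%C
        with ((1 - Cconj y * psi z) + (1 - s * s)%R * (Cconj y * psi z))%C.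
      2: { rewrite RtoC_minus, RtoC_mult, Cmult_conj.
           replace (Cconj s) with (RtoC s) by (unfold Cconj, RtoC; simpl; f_equal; ring). ring. }
      eapply Rle_trans. apply Cmod_triangle. apply Rplus_le_compat_l.
      rewrite !Cmod_mult, Cmod_conj, Cmod_R, Rabs_pos_eq by nra.
      assert (X := Hb z Hz). assert (X1 := Cmod_ge_0 (psi z)). assert (X2 := Cmod_ge_0 y).
      assert (Cmod y * Cmod (psi z) <= 1) by nra.
      rewrite <- (Rmult_1_r (1 - s * s)) at 2. apply Rmult_le_compat_l; nra. }
    assert (0 <= 1 - s * s) by nra.
    apply Rle_trans with (Cmod z * (B + (1 - s * s))). now apply Rmult_le_compat_l. nra. }
  apply Rnot_lt_le. intros Hlt. set (g := A - Cmod z * B).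
  assert (Hg : 0 < g <= A) by (unfold g; nra).
  (* for this [s] the error [1 - s * s] and the loss [(1 - s) * A] together stay below the gap [g] *)
  set (s := 1 - g / (2 * (A + 2))).
  assert (Hq : 0 < g / (2 * (A + 2)) < 1).
  { split. apply Rdiv_lt_0_compat; lra. apply (Rmult_lt_reg_r (2 * (A + 2))). lra.
    unfold Rdiv. rewrite Rmult_assoc, Rinv_l by lra. lra. }
  assert (X := Hlim s ltac:(unfold s; lra)).
  assert (Y : (1 - s) * (A + 2) = g / 2) by (unfold s; field; lra).
  assert (Hs1 : 0 < s < 1) by (unfold s; lra).
  unfold g in *. nra.
Qed.

(** After squaring, the worst case is [Re (conj y * x) = |x| |y|], in which the
    inequality reads [(|x| - |y|)^2 <= r^2 (1 - |x| |y|)^2]. *)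
Lemma schwarz_pick_growth (x y : C) r :
  0 <= r < 1 -> Cmod x <= 1 -> Cmod y <= 1 ->
  Cmod (x - y)%C <= r * Cmod (1 - Cconj y * x)%C ->
  Cmod x * (1 + Cmod y * r) <= r + Cmod y.
Proof.
  intros Hr Hx Hy H.
  assert (H0 := Cmod_ge_0 (x - y)%C). assert (X0 := Cmod_ge_0 x). assert (Y0 := Cmod_ge_0 y).
  assert (Hsq : normsq (x - y)%C <= r * r * normsq (1 - Cconj y * x)%C).
  { rewrite !normsq_Cmod. assert (H1 := Cmod_ge_0 (1 - Cconj y * x)%C). nra. }
  set (m := Re (Cconj y * x)%C).
  assert (Hm : m <= Cmod y * Cmod x).
  { rewrite <- (Cmod_conj y), <- Cmod_mult. eapply Rle_trans. apply Rle_abs. apply re_le_Cmod. }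
  assert (E1 : normsq (x - y)%C = Cmod x * Cmod x + Cmod y * Cmod y - 2 * m).
  { rewrite <- !normsq_Cmod. unfold m, normsq. destruct x, y; simpl. ring. }
  assert (E2 : normsq (1 - Cconj y * x)%C = 1 + (Cmod x * Cmod x) * (Cmod y * Cmod y) - 2 * m).
  { rewrite <- !normsq_Cmod. unfold m, normsq. destruct x, y; simpl. ring. }
  rewrite E1, E2 in Hsq. set (p := Cmod x) in *. set (q := Cmod y) in *.
  assert (Hpq : 0 <= 1 - q * p) by nra.
  assert (Hsq2 : (p - q) * (p - q) <= (r * (1 - q * p)) * (r * (1 - q * p))).
  { assert ((1 - r * r) * m <= (1 - r * r) * (q * p)) by (apply Rmult_le_compat_l; nra). nra. }
  assert (p - q <= r * (1 - q * p)).
  { apply Rnot_lt_le. intros Hlt. assert (0 <= r * (1 - q * p)) by (apply Rmult_le_pos; lra). nra. }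
  lra.
Qed.

(** The extremal value is [x = (r + al) / (1 + al r)], for which the difference of
    the two sides is a positive multiple of [(1 - r)^2 (2 r + 1 + al)].  The
    resulting rate [2 (1 + al) / (3 + al)] is the limit, as [r] tends to 1, of
    [(1 - r) * 2 r x / (1 - r^2 x)]. *)
Lemma pre_schwarzian_rate x r al :
  0 <= r < 1 -> 0 <= al <= 1 -> 0 <= x -> x * (1 + al * r) <= r + al ->
  r * x * (1 - r) * (3 + al) <= (1 + al) * (1 - r * r * x).
Proof.
  intros Hr Hal Hx H.
  set (k := r * (1 - r) * (3 + al) + (1 + al) * (r * r)).
  assert (Hk : 0 <= k).
  { unfold k. apply Rplus_le_le_0_compat; repeat apply Rmult_le_pos; lra. }
  assert (Hkey : (r + al) * k <= (1 + al) * (1 + al * r)).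
  { assert (E : (1 + al) * (1 + al * r) - (r + al) * k = (1 - r) * (1 - r) * (2 * r + 1 + al))
      by (unfold k; ring).
    assert (0 <= (1 - r) * (1 - r) * (2 * r + 1 + al)) by (repeat apply Rmult_le_pos; lra). lra. }
  assert (Hp : 0 < 1 + al * r) by nra.
  assert (x * k <= 1 + al).
  { apply (Rmult_le_reg_r (1 + al * r)); auto.
    apply Rle_trans with ((r + al) * k). 2: lra.
    replace (x * k * (1 + al * r)) with (x * (1 + al * r) * k) by ring.
    now apply Rmult_le_compat_r. }
  unfold k in *. lra.
Qed.

(** * From growth of the derivative to Holder continuity *)

Lemma Cmod_path (s : R) (z : C) : 0 <= s -> Cmod (0 + s * z)%C = s * Cmod z.
Proof.
  intros Hs. rewrite Cplus_0_l, Cmod_mult, Cmod_R, Rabs_pos_eq; auto.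
Qed.

Lemma weighted_normsq_derive (X Y : R -> R) s dx dy b r :
  is_derive X s dx -> is_derive Y s dy -> s * r < 1 ->
  is_derive (fun x => (X x * X x + Y x * Y x) * exp (2 * b * ln (1 - x * r))) s
    (2 * ((X s * dx + Y s * dy) - (X s * X s + Y s * Y s) * (b * r / (1 - s * r)))
     * exp (2 * b * ln (1 - s * r))).
Proof.
  intros HX HY Hs. auto_derive.
  - repeat split; try (eexists; eassumption); lra.
  - rewrite (is_derive_unique (fun x : R => X x) s dx HX), (is_derive_unique (fun x : R => Y x) s dy HY).
    replace (1 + - (s * r)) with (1 - s * r) by ring. field. lra.
Qed.

(** The hypothesis says that [|g'| / |g| <= b / (1 - |z|)]; hence
    [|g|^2 (1 - |z|)^(2 b)] is nonincreasing along every radius.  The square is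
    used because it is differentiable without knowing that [g] has no zeros. *)
Theorem growth_of_log_derivative a b :
  summable a -> 0 <= b ->
  (forall z, Cmod z < 1 ->
     Cmod (psum (derived a) z) * (1 - Cmod z) <= b * Cmod (psum a z)) ->
  forall z, Cmod z < 1 -> Cmod (psum a z) <= Cmod (a 0%nat) * Rpower (1 - Cmod z) (- b).
Proof.
  intros Ha Hb Hlog z Hz. assert (Hz0 := Cmod_ge_0 z).
  set (r := Cmod z) in *. set (g := psum a) in *.
  set (F := fun s : R => (Re (1 * g (0 + s * z))%C * Re (1 * g (0 + s * z))%C
     + Re (- Ci * g (0 + s * z))%C * Re (- Ci * g (0 + s * z))%C) * exp (2 * b * ln (1 - s * r))).
  assert (HN : forall s : R, Re (1 * g (0 + s * z))%C * Re (1 * g (0 + s * z))%C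
     + Re (- Ci * g (0 + s * z))%C * Re (- Ci * g (0 + s * z))%C = normsq (g (0 + s * z))%C).
  { intros s. generalize (g (0 + s * z)%C). intros [x y]. unfold normsq. simpl. ring. }
  assert (Hdisk : forall s, 0 <= s <= 1 -> Cmod (0 + s * z)%C < 1).
  { intros s Hs. rewrite Cmod_path by lra. fold r. nra. }
  assert (Hdec : F 1 <= F 0).
  { apply (nonincreasing_of_derive F (fun s => 
     2 * ((Re (1 * g (0 + s * z))%C * Re (1 * (z * psum (derived a) (0 + s * z)))%C
          + Re (- Ci * g (0 + s * z))%C * Re (- Ci * (z * psum (derived a) (0 + s * z)))%C)
       - (Re (1 * g (0 + s * z))%C * Re (1 * g (0 + s * z))%C
          + Re (- Ci * g (0 + s * z))%C * Re (- Ci * g (0 + s * z))%C) * (b * r / (1 - s * r)))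
       * exp (2 * b * ln (1 - s * r)))).
    - lra.
    - intros s Hs. unfold F.
      apply (weighted_normsq_derive (fun s : R => Re (1 * g (0 + s * z))%C)
        (fun s : R => Re (- Ci * g (0 + s * z))%C)).
      apply psum_path_derive; auto. apply psum_path_derive; auto. nra.
    - intros s Hs. rewrite HN.
      assert (Hl := Hlog _ (Hdisk s Hs)). rewrite Cmod_path in Hl by lra. fold r in Hl.
      fold g in Hl.
      assert (HE : 0 < exp (2 * b * ln (1 - s * r))) by apply exp_pos.
      set (v := g (0 + s * z)%C) in *. set (w := psum (derived a) (0 + s * z)%C) in *.
      assert (HR : Re (1 * v)%C * Re (1 * (z * w))%C + Re (- Ci * v)%C * Re (- Ci * (z * w))%C
         <= Cmod v * (r * Cmod w)).
      { replace (Re (1 * v)%C * Re (1 * (z * w))%C + Re (- Ci * v)%C * Re (- Ci * (z * w))%C)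
          with (Re (Cconj v * (z * w))%C).
        - eapply Rle_trans. apply Rle_abs. eapply Rle_trans. apply re_le_Cmod.
          rewrite !Cmod_mult, Cmod_conj. right. reflexivity.
        - destruct v, w, z. simpl. ring. }
      assert (H1 : 0 < 1 - s * r) by nra.
      assert (Hw : Cmod w <= b * Cmod v / (1 - s * r)).
      { apply (Rmult_le_reg_r (1 - s * r)); auto. unfold Rdiv.
        rewrite Rmult_assoc, Rinv_l by lra. lra. }
      assert (Hv := Cmod_ge_0 v).
      assert (Cmod v * (r * Cmod w) <= normsq v * (b * r / (1 - s * r))).
      { rewrite normsq_Cmod.
        replace (Cmod v * Cmod v * (b * r / (1 - s * r))) with (Cmod v * (r * (b * Cmod v / (1 - s * r))))
          by (field; lra).
        apply Rmult_le_compat_l; auto. apply Rmult_le_compat_l; auto. }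
      nra. }
  unfold F in Hdec. rewrite !HN in Hdec.
  replace (0 + 1 * z)%C with z in Hdec by ring. replace (0 + 0 * z)%C with (RtoC 0) in Hdec by ring.
  replace (1 - 0 * r) with 1 in Hdec by ring. rewrite ln_1, Rmult_0_r, exp_0, Rmult_1_r in Hdec.
  rewrite Rmult_1_l in Hdec. unfold g in Hdec at 2. rewrite psum_0 in Hdec by auto.
  rewrite !normsq_Cmod in Hdec.
  assert (E : exp (2 * b * ln (1 - r)) = exp (b * ln (1 - r)) * exp (b * ln (1 - r))).
  { rewrite <- exp_plus. f_equal. ring. }
  rewrite E in Hdec. unfold Rpower.
  replace (- b * ln (1 - r)) with (- (b * ln (1 - r))) by ring. rewrite exp_Ropp.
  set (e := exp (b * ln (1 - r))) in *. assert (He : 0 < e) by apply exp_pos.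
  assert (Hg := Cmod_ge_0 (g z)). assert (Ha0 := Cmod_ge_0 (a 0%nat)).
  assert (Cmod (g z) * e <= Cmod (a 0%nat)).
  { apply Rsqr_incr_0_var; auto. unfold Rsqr. lra. }
  apply (Rmult_le_reg_r e); auto. rewrite Rmult_assoc, Rinv_l; lra.
Qed.

Lemma Rpower_pos x y : 0 < Rpower x y.
Proof. apply exp_pos. Qed.

Lemma Rpower_subadditive x y t :
  0 < x -> 0 < y -> 0 < t <= 1 -> Rpower (x + y) t <= Rpower x t + Rpower y t.
Proof.
  intros Hx Hy Ht.
  assert (K : forall u, 0 < u <= x + y -> u * Rpower (x + y) (t - 1) <= Rpower u t).
  { intros u Hu. rewrite <- (Rpower_1 u) at 1 by lra.
    replace t with (1 + (t - 1)) at 2 by ring. rewrite Rpower_plus.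
    apply Rmult_le_compat_l. left; apply Rpower_pos.
    replace (t - 1) with (- (1 - t)) by ring. rewrite !Rpower_Ropp.
    apply Rinv_le_contravar. apply Rpower_pos. apply Rle_Rpower_l; lra. }
  assert (K1 := K x ltac:(lra)). assert (K2 := K y ltac:(lra)).
  replace t with (1 + (t - 1)) at 1 by ring. rewrite Rpower_plus, Rpower_1 by lra. lra.
Qed.

Lemma Rpower_decr x y t : 0 < x <= y -> t <= 1 -> Rpower y (t - 1) <= Rpower x (t - 1).
Proof.
  intros Hxy Ht. replace (t - 1) with (- (1 - t)) by ring. rewrite !Rpower_Ropp.
  apply Rinv_le_contravar. apply Rpower_pos. apply Rle_Rpower_l; lra.
Qed.

(** Integrating [(1 - s r)^(t - 1)] along a radius gives a difference of two
    powers of exponent [t], which is controlled by subadditivity. *)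
Lemma radial_increment a t z d :
  summable a -> 0 < t <= 1 ->
  (forall z, Cmod z < 1 -> Cmod (psum (derived a) z) <= Rpower (1 - Cmod z) (t - 1)) ->
  Cmod z < 1 -> 0 < d < 1 ->
  Cmod (psum a z - psum a ((1 - d)%R * z))%C <= Rpower d t / t.
Proof.
  intros Ha Ht Hg Hz Hd. assert (Hz0 := Cmod_ge_0 z). set (r := Cmod z) in *.
  assert (H := path_increment a 0%C z (fun s => - / t * Rpower (1 - s * r) t)
     (fun s => r * Rpower (1 - s * r) (t - 1)) (1 - d) 1 Ha).
  replace (0 + 1 * z)%C with z in H by ring.
  replace (0 + (1 - d)%R * z)%C with ((1 - d)%R * z)%C in H by ring.
  eapply Rle_trans. apply H.
  - lra.
  - intros s Hs. rewrite Cmod_path by lra. fold r. nra.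
  - intros s Hs. assert (0 < 1 - s * r) by nra. unfold Rpower. auto_derive. lra.
    replace (1 + - (s * r)) with (1 - s * r) by ring.
    replace ((t - 1) * ln (1 - s * r)) with (t * ln (1 - s * r) + - ln (1 - s * r)) by ring.
    rewrite exp_plus, exp_Ropp, exp_ln by lra. field. lra.
  - intros s Hs. rewrite Cmod_mult. fold r. apply Rmult_le_compat_l; auto.
    eapply Rle_trans. apply Hg. rewrite Cmod_path by lra. fold r; nra.
    rewrite Cmod_path by lra. fold r. lra.
  - replace (1 - 1 * r) with (1 - r) by ring.
    assert (Rpower (1 - (1 - d) * r) t - Rpower (1 - r) t <= Rpower d t).
    { destruct (Req_dec r 0) as [E|E].
      - rewrite E. replace (1 - (1 - d) * 0) with (1 - 0) by ring.
        assert (X := Rpower_pos d t). lra.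
      - replace (1 - (1 - d) * r) with ((1 - r) + d * r) by ring.
        assert (X := Rpower_subadditive (1 - r) (d * r) t ltac:(lra) ltac:(nra) Ht).
        assert (Y := Rle_Rpower_l (d * r) d t ltac:(lra) ltac:(split; nra)). lra. }
    unfold Rdiv. apply Rle_trans with ((Rpower (1 - (1 - d) * r) t - Rpower (1 - r) t) * / t).
    right; ring. apply Rmult_le_compat_r; auto. left. apply Rinv_0_lt_compat; lra.
Qed.

(** Move from both points towards the centre by the factor [1 - d], with [d] half
    their distance.  Each radial part costs [d^t / t], and the segment between the
    new points lies where the derivative is at most [d^(t - 1)]. *)
Theorem hardy_littlewood a t :
  summable a -> 0 < t <= 1 ->
  (forall z, Cmod z < 1 -> Cmod (psum (derived a) z) <= Rpower (1 - Cmod z) (t - 1)) ->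
  forall z w, Cmod z < 1 -> Cmod w < 1 ->
    Cmod (psum a z - psum a w)%C <= (2 / t + 2) * Rpower (Cmod (z - w)%C) t.
Proof.
  intros Ha Ht Hg z w Hz Hw.
  assert (Hti : 0 < / t) by (apply Rinv_0_lt_compat; lra).
  destruct (Ceq_dec z w) as [->|Hne].
  { rewrite Cmod_refl at 1. apply Rmult_le_pos. unfold Rdiv; lra. left; apply Rpower_pos. }
  assert (Hp : 0 < Cmod (z - w)%C).
  { apply Cmod_gt_0. intros E. apply Hne. replace z with (z - w + w)%C by ring. rewrite E; ring. }
  assert (Hp2 : Cmod (z - w)%C < 2).
  { eapply Rle_lt_trans. apply Cmod_triangle. rewrite Cmod_opp. lra. }
  set (d := Cmod (z - w)%C / 2).
  assert (Hd : 0 < d < 1) by (unfold d; lra).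
  assert (R1 := radial_increment a t z d Ha Ht Hg Hz Hd).
  assert (R2 := radial_increment a t w d Ha Ht Hg Hw Hd).
  set (z' := ((1 - d)%R * z)%C) in *. set (w' := ((1 - d)%R * w)%C) in *.
  assert (Mz : Cmod z' <= 1 - d).
  { unfold z'. rewrite Cmod_mult, Cmod_R, Rabs_pos_eq by lra. nra. }
  assert (Mw : Cmod w' <= 1 - d).
  { unfold w'. rewrite Cmod_mult, Cmod_R, Rabs_pos_eq by lra. nra. }
  assert (S : Cmod (psum a z' - psum a w')%C <= Rpower d (t - 1) * Cmod (z' - w')%C).
  { apply segment_increment; auto; try lra. intros s Hs.
    assert (Hin : Cmod (w' + s * (z' - w'))%C <= 1 - d).
    { apply segment_in_disk; auto. now replace (w' + (z' - w'))%C with z' by ring. }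
    eapply Rle_trans. apply Hg. lra. apply Rpower_decr; lra. }
  assert (Hzw : Cmod (z' - w')%C <= 2 * d).
  { unfold z', w'. replace ((1 - d)%R * z - (1 - d)%R * w)%C with ((1 - d)%R * (z - w))%C by ring.
    rewrite Cmod_mult, Cmod_R, Rabs_pos_eq by lra. unfold d in *. nra. }
  assert (S2 : Cmod (psum a z' - psum a w')%C <= 2 * Rpower d t).
  { eapply Rle_trans. apply S.
    apply Rle_trans with (Rpower d (t - 1) * (2 * d)).
    apply Rmult_le_compat_l; auto. left; apply Rpower_pos.
    replace (Rpower d t) with (Rpower d (1 + (t - 1))) by (f_equal; ring).
    rewrite Rpower_plus, Rpower_1 by lra. right; ring. }
  assert (Hmono : Rpower d t <= Rpower (Cmod (z - w)%C) t) by (apply Rle_Rpower_l; unfold d; lra).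
  replace (psum a z - psum a w)%C with ((psum a z - psum a z') + ((psum a z' - psum a w') - (psum a w - psum a w')))%C by ring.
  eapply Rle_trans. apply Cmod_triangle.
  assert (T := Cmod_triangle (psum a z' - psum a w')%C (- (psum a w - psum a w'))%C).
  rewrite Cmod_opp in T. fold (Cminus (psum a z' - psum a w')%C (psum a w - psum a w')%C) in T.
  apply Rle_trans with ((2 / t + 2) * Rpower d t). unfold Rdiv in *; lra.
  apply Rmult_le_compat_l; auto. unfold Rdiv; lra.
Qed.

Lemma Rpower_small K t e : 0 < K -> 0 < t -> 0 < e ->
  exists d, 0 < d /\ forall x, 0 < x < d -> K * Rpower x t < e.
Proof.
  intros HK Ht He. exists (Rpower (e / K) (/ t)). split. apply Rpower_pos.
  intros x Hx. assert (H := Rlt_Rpower_l x _ t Ht Hx).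
  rewrite Rpower_mult, Rinv_l, Rpower_1 in H; try lra. 2: now apply Rdiv_lt_0_compat.
  apply (Rmult_lt_compat_l K) in H; auto. replace (K * (e / K)) with e in H by (field; lra). auto.
Qed.

Lemma holder_uniform (D : C -> Prop) (f : C -> C) K t e :
  0 < K -> 0 < t -> 0 < e ->
  (forall z w, D z -> D w -> Cmod (f z - f w)%C <= K * Rpower (Cmod (z - w)%C) t) ->
  exists d, 0 < d /\ forall z w, D z -> D w -> Cmod (z - w)%C < d -> Cmod (f z - f w)%C < e.
Proof.
  intros HK Ht He Hf. destruct (Rpower_small K t e HK Ht He) as (d & Hd & Hs).
  exists d. split; auto. intros z w Hz Hw Hzw.
  destruct (Ceq_dec z w) as [->|Hne]. now rewrite Cmod_refl.
  eapply Rle_lt_trans. apply Hf; auto. apply Hs. split; auto.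
  apply Cmod_gt_0. intros E. apply Hne. replace z with (z - w + w)%C by ring. rewrite E; ring.
Qed.

Lemma clim_cauchy (u : nat -> C) :
  (forall e, 0 < e -> exists N, forall n m, (N <= n)%nat -> (N <= m)%nat -> Cmod (u n - u m)%C < e) ->
  exists l, clim u l.
Proof.
  intros Hu.
  assert (A : forall p : C -> R, (forall x y, p x - p y = p (x - y)%C) ->
     (forall c, Rabs (p c) <= Cmod c) -> exists l : R, is_lim_seq (fun n => p (u n)) l).
  { intros p Hp Hb. apply (proj2 (ex_lim_seq_cauchy_corr _)). intros e.
    destruct (Hu e (cond_pos e)) as [N HN]. exists N. intros n m Hn Hm.
    rewrite Hp. eapply Rle_lt_trans. apply Hb. auto. }
  destruct (A Re) as [x Hx]. intros; reflexivity. apply re_le_Cmod.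
  destruct (A Im) as [y Hy]. intros; reflexivity. apply im_le_Cmod.
  exists (x, y). unfold clim.
  apply is_lim_seq_squeeze_0 with (fun n => Rabs (Re (u n) - x) + Rabs (Im (u n) - y)).
  - intros n. split. apply Cmod_ge_0. apply (Cmod_le_re_im (u n - (x, y))%C).
  - replace (Finite 0) with (Finite (Rabs (x - x) + Rabs (y - y))).
    2: { f_equal. rewrite !Rminus_diag, Rabs_R0. ring. }
    apply is_lim_seq_plus'; apply (is_lim_seq_abs _ (Finite _));
      apply is_lim_seq_minus'; auto; apply is_lim_seq_const.
Qed.

(** The values at [rho_n z] with [rho_n] increasing to 1 form a Cauchy sequence,
    uniformly for [z] in the closed disk. *)
Theorem holder_extension (f : C -> C) K t :
  0 < K -> 0 < t ->
  (forall z w, Cmod z < 1 -> Cmod w < 1 ->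
     Cmod (f z - f w)%C <= K * Rpower (Cmod (z - w)%C) t) ->
  exists F : C -> C,
    (forall z, Cmod z < 1 -> F z = f z) /\
    (forall z w, Cmod z <= 1 -> Cmod w <= 1 -> Cmod (F z - F w)%C <= K * Rpower (Cmod (z - w)%C) t).
Proof.
  intros HK Ht Hf.
  set (rho := fun n => 1 - / (INR n + 1)).
  assert (Hinv : forall n, 0 < / (INR n + 1) <= 1).
  { intros n. assert (H := pos_INR n). split. apply Rinv_0_lt_compat; lra.
    rewrite <- Rinv_1. apply Rinv_le_contravar; lra. }
  assert (Hrho : forall n, 0 <= rho n < 1) by (intros n; assert (H := Hinv n); unfold rho; lra).
  assert (Hsmall : forall e, 0 < e -> exists N, forall n, (N <= n)%nat -> / (INR n + 1) < e).
  { intros e He. destruct (archimed_cor1 e He) as (N & HN & HNp). exists N. intros n Hn.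
    apply Rlt_trans with (2 := HN). apply Rinv_lt_contravar.
    - apply Rmult_lt_0_compat. now apply lt_0_INR. assert (H := pos_INR n). lra.
    - apply le_INR in Hn. lra. }
  assert (Hdisk : forall n z, Cmod z <= 1 -> Cmod (rho n * z)%C < 1).
  { intros n z Hz. assert (H := Hrho n). rewrite Cmod_mult, Cmod_R, Rabs_pos_eq by lra.
    assert (X := Cmod_ge_0 z). nra. }
  assert (Hex : forall z, exists l, Cmod z <= 1 -> clim (fun n => f (rho n * z)%C) l).
  { intros z. destruct (Rle_dec (Cmod z) 1) as [Hz|Hz]. 2: exists 0%C; intros; contradiction.
    destruct (clim_cauchy (fun n => f (rho n * z)%C)) as [l Hl].
    - intros e He.
      destruct (holder_uniform (fun z => Cmod z < 1) f K t e HK Ht He Hf) as (d & Hd & Hu).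
      destruct (Hsmall d Hd) as [N HN]. exists N. intros n m Hn Hm. apply Hu; auto.
      replace (rho n * z - rho m * z)%C with ((rho n - rho m)%R * z)%C by (rewrite RtoC_minus; ring).
      rewrite Cmod_mult, Cmod_R. assert (X := Cmod_ge_0 z).
      apply Rle_lt_trans with (Rabs (rho n - rho m)).
      { assert (Y := Rabs_pos (rho n - rho m)). nra. }
      assert (X1 := HN n Hn). assert (X2 := HN m Hm). assert (X3 := Hinv n). assert (X4 := Hinv m).
      unfold rho. apply Rabs_def1; lra.
    - exists l. auto. }
  destruct (functional_choice _ Hex) as [F HF]. exists F. split.
  - intros z Hz. apply clim_unique with (fun n => f (rho n * z)%C). apply HF; lra.
    unfold clim. apply is_lim_seq_spec. intros e.
    destruct (holder_uniform (fun z => Cmod z < 1) f K t e HK Ht (cond_pos e) Hf) as (d & Hd & Hu).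
    destruct (Hsmall d Hd) as [N HN]. exists N. intros n Hn.
    rewrite Rminus_0_r, Rabs_pos_eq by apply Cmod_ge_0. apply Hu; auto. apply Hdisk; lra.
    replace (rho n * z - z)%C with ((- / (INR n + 1))%R * z)%C
      by (unfold rho; rewrite RtoC_minus, RtoC_opp; ring).
    rewrite Cmod_mult, Cmod_R, Rabs_Ropp, Rabs_pos_eq by (left; apply Hinv).
    specialize (HN n Hn). assert (X := Cmod_ge_0 z). assert (X2 := Hinv n). nra.
  - intros z w Hz Hw.
    apply clim_bound with (fun n => f (rho n * z) - f (rho n * w))%C.
    2: apply clim_minus; auto.
    intros n. destruct (Ceq_dec (rho n * z)%C (rho n * w)%C) as [->|Hne].
    { rewrite Cmod_refl. apply Rmult_le_pos. lra. left; apply Rpower_pos. }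
    eapply Rle_trans. apply Hf; auto. apply Rmult_le_compat_l. lra.
    apply Rle_Rpower_l. lra.
    replace (rho n * z - rho n * w)%C with (rho n * (z - w))%C by ring. split.
    + apply Cmod_gt_0. intros E. apply Hne.
      replace (rho n * z)%C with (rho n * (z - w) + rho n * w)%C by ring. rewrite E. ring.
    + rewrite Cmod_mult, Cmod_R, Rabs_pos_eq by apply Hrho.
      assert (X := Cmod_ge_0 (z - w)%C). assert (Y := Hrho n). nra.
Qed.

Lemma holder_continuous_on (F : C -> C) K t :
  0 < K -> 0 < t ->
  (forall z w, Cmod z <= 1 -> Cmod w <= 1 -> Cmod (F z - F w)%C <= K * Rpower (Cmod (z - w)%C) t) ->
  continuous_on closed_unit_disk F.
Proof.
  intros HK Ht HF z Hz P [e HP].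
  destruct (holder_uniform (fun z => Cmod z <= 1) F K t e HK Ht (cond_pos e) HF) as (d & Hd & Hu).
  assert (Hd2 : 0 < d / 2) by lra.
  exists (mkposreal _ Hd2). intros w [Hw1 Hw2] HwD. apply HP.
  apply C_NormedModule_mixin_compat1. apply Hu; auto.
  eapply Rle_lt_trans. apply Cmod_le_re_im.
  change (Rabs (fst w - fst z) < d / 2) in Hw1. change (Rabs (snd w - snd z) < d / 2) in Hw2.
  change (Rabs (fst w - fst z) + Rabs (snd w - snd z) < d). lra.
Qed.

Lemma Cmod_cis x : Cmod (cis x) = 1.
Proof.
  unfold cis, Cmod. simpl. rewrite !Rmult_1_r.
  replace (cos x * cos x + sin x * sin x) with (Rsqr (sin x) + Rsqr (cos x)) by (unfold Rsqr; ring).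
  rewrite sin2_cos2. apply sqrt_1.
Qed.

Lemma Rabs_sin_le x : Rabs (sin x) <= Rabs x.
Proof.
  assert (P : forall y, 0 < y -> Rabs (sin y) <= y).
  { intros y Hy. apply Rabs_le. split. 2: left; now apply sin_lt_x.
    destruct (Rle_dec y PI) as [H|H].
    - assert (0 <= sin y) by (apply sin_ge_0; lra). lra.
    - assert (X := SIN_bound y). assert (Y := PI2_1). lra. }
  destruct (Rtotal_order x 0) as [H|[H|H]].
  - rewrite <- (Rabs_Ropp x), <- Rabs_Ropp, <- sin_neg, (Rabs_pos_eq (- x)) by lra. apply P; lra.
  - subst. rewrite sin_0, Rabs_R0. lra.
  - rewrite (Rabs_pos_eq x) by lra. now apply P.
Qed.

Lemma cis_lipschitz x y : Cmod (cis x - cis y)%C <= Rabs (x - y).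
Proof.
  apply Rsqr_incr_0_var. 2: apply Rabs_pos. rewrite <- Rsqr_abs. unfold Rsqr at 1.
  rewrite <- normsq_Cmod.
  assert (E : normsq (cis x - cis y)%C = 2 - 2 * cos (x - y)).
  { unfold normsq, cis. simpl. rewrite cos_minus.
    assert (Hx := sin2_cos2 x). assert (Hy := sin2_cos2 y). unfold Rsqr in *. lra. }
  rewrite E. set (u := (x - y) / 2). replace (x - y) with (2 * u) by (unfold u; field).
  rewrite cos_2a_sin.
  assert (H := Rsqr_le_abs_1 _ _ (Rabs_sin_le u)). unfold Rsqr in *. lra.
Qed.

Lemma holder_boundary (F : C -> C) K t :
  0 < K -> 0 < t <= 1 ->
  (forall z w, Cmod z <= 1 -> Cmod w <= 1 -> Cmod (F z - F w)%C <= K * Rpower (Cmod (z - w)%C) t) ->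
  Lambda t (fun theta => F (cis theta)).
Proof.
  intros HK Ht HF. split; auto. exists K. split; auto. intros x y _ _.
  destruct (Ceq_dec (cis x) (cis y)) as [->|Hne].
  { rewrite Cmod_refl. apply Rmult_le_pos. lra. left; apply Rpower_pos. }
  eapply Rle_trans. apply HF; rewrite Cmod_cis; lra.
  apply Rmult_le_compat_l. lra. apply Rle_Rpower_l. lra. split. 2: apply cis_lipschitz.
  apply Cmod_gt_0. intros E. apply Hne. replace (cis x) with (cis x - cis y + cis y)%C by ring.
  rewrite E; ring.
Qed.

(** * The extremal case: parallel strips *)

Lemma constant_of_derive (F : R -> R) s0 s1 :
  s0 <= s1 -> (forall s, s0 <= s <= s1 -> is_derive F s 0) -> F s1 = F s0.
Proof.
  intros Hs HF. apply Rle_antisym.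
  - apply (nonincreasing_of_derive F (fun _ => 0)); auto. intros; lra.
  - apply Ropp_le_cancel. apply (nonincreasing_of_derive (fun s => - F s) (fun _ => 0)); auto.
    + intros s Hss. replace 0 with (- 0) by ring. apply (is_derive_opp F). auto.
    + intros; lra.
Qed.

Lemma C_eq_of_Re (x y : C) : Re (1 * x)%C = Re (1 * y)%C -> Re (- Ci * x)%C = Re (- Ci * y)%C -> x = y.
Proof.
  destruct x as [x1 x2], y as [y1 y2]. simpl. intros H1 H2. f_equal; lra.
Qed.

(** The differential equation says that the derivative of the left-hand side is
    zero. *)
Lemma derivative_of_extremal a l z :
  summable a -> a 0%nat = 1%C ->
  (forall z, Cmod z < 1 -> psum (derived a) z * (1 - z * z * l) = 2 * z * l * psum a z)%C ->
  Cmod z < 1 -> (psum a z * (1 - l * z * z) = 1)%C.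
Proof.
  intros Ha H0 Hode Hz. assert (Hz0 := Cmod_ge_0 z).
  assert (Hin : forall s, 0 <= s <= 1 -> Cmod (0 + s * z)%C < 1).
  { intros s Hs. rewrite Cmod_path by lra. nra. }
  set (G := fun s : R => (psum a (0 + s * z) * (1 - l * (s * z) * (s * z)))%C).
  assert (Hc : forall u : C, Re (u * G 1)%C = Re (u * G 0)%C).
  { intros u.
    assert (E : forall s, Re (u * G s)%C = Re (u * psum a (0 + s * z))%C
        - s * s * Re (u * l * z * z * psum a (0 + s * z))%C).
    { intros s. unfold G. generalize (psum a (0 + s * z)%C). intros [p1 p2].
      destruct u, l, z. simpl. ring. }
    rewrite !E.
    apply (constant_of_derive (fun s => Re (u * psum a (0 + s * z))%C
        - s * s * Re (u * l * z * z * psum a (0 + s * z))%C)). lra.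
    intros s Hs.
    assert (D1 := psum_path_derive a u 0%C z s Ha (Hin s Hs)).
    assert (D2 := psum_path_derive a (u * l * z * z)%C 0%C z s Ha (Hin s Hs)).
    assert (D3 : is_derive (fun s : R => s * s) s (2 * s)) by (auto_derive; auto; ring).
    assert (D4 := is_derive_mult (K := R_AbsRing) _ _ _ _ _ D3 D2 Rmult_comm).
    assert (D5 := is_derive_minus _ _ _ _ _ D1 D4).
    apply (is_derive_ext (fun s : R => minus (Re (u * psum a (0 + s * z))%C)
       (mult (s * s) (Re (u * l * z * z * psum a (0 + s * z))%C)))). intros; reflexivity.
    eapply is_derive_ext. 2: { evar_last. exact D5. 
    specialize (Hode _ (Hin s Hs)). cbv beta.
    set (fp := psum a (0 + s * z)%C) in *. set (fpp := psum (derived a) (0 + s * z)%C) in *.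
    rewrite Cplus_0_l in Hode.
    transitivity (Re (u * z * (fpp * (1 - s * z * (s * z) * l) - 2 * (s * z) * l * fp))%C).
    - clearbody fp fpp. destruct u, l, z, fp, fpp. unfold minus, plus, opp, mult. simpl. ring.
    - rewrite Hode. replace (u * z * (2 * (s * z) * l * fp - 2 * (s * z) * l * fp))%C with (RtoC 0) by ring.
      reflexivity. }
    intros; reflexivity. }
  assert (E : G 1 = G 0) by (apply C_eq_of_Re; apply Hc).
  unfold G in E.
  replace (0 + 1 * z)%C with z in E by ring. replace (0 + 0 * z)%C with (RtoC 0) in E by ring.
  rewrite psum_0, H0 in E by auto.
  replace (1 - l * z * z)%C with (1 - l * (1 * z) * (1 * z))%C by ring. rewrite E. ring.
Qed.

(** The bisector [(1 + p) / |1 + p|] is a square root of [p] unless [p = -1]. *)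
Lemma unimodular_sqrt (p : C) : Cmod p = 1 -> exists l, Cmod l = 1 /\ (l * l)%C = p.
Proof.
  intros Hp. destruct (Ceq_dec p (- (1))%C) as [->|Hne].
  - exists Ci. split. apply Cmod_Ci. unfold Ci, Cmult, Copp, RtoC; simpl; f_equal; ring.
  - assert (Hn : (1 + p)%C <> 0%C).
    { intros E. apply Hne. replace p with (1 + p - 1)%C by ring. rewrite E. ring. }
    assert (Hm := proj1 (Cmod_gt_0 _) Hn).
    assert (Hm' : RtoC (Cmod (1 + p)) <> 0%C) by (intros E; apply RtoC_inj in E; lra).
    exists ((1 + p) / Cmod (1 + p))%C. split.
    + rewrite Cmod_div by auto. rewrite Cmod_R, Rabs_pos_eq by lra. field. lra.
    + assert (E : (RtoC (Cmod (1 + p)) * RtoC (Cmod (1 + p)) * p = (1 + p) * (1 + p))%C).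
      { rewrite <- RtoC_mult, <- normsq_Cmod. assert (N : normsq p = 1) by (rewrite normsq_Cmod, Hp; ring).
        destruct p as [x y]. unfold normsq in N. simpl in N.
        assert (E : normsq (1 + (x, y))%C = 2 + 2 * x) by (unfold normsq; simpl; lra).
        rewrite E. unfold Cmult, Cplus, RtoC; simpl. f_equal; lra. }
      transitivity ((1 + p) * (1 + p) / (RtoC (Cmod (1 + p)) * RtoC (Cmod (1 + p))))%C.
      field; auto. rewrite <- E. field; auto.
Qed.

Lemma Carg_right_half_plane w : 0 < Re w -> Carg w = atan (Im w / Re w).
Proof.
  intros Hre. set (q := Im w / Re w).
  assert (E : Re w / Cmod w = cos (atan q)).
  { rewrite cos_atan. assert (Hq : Cmod w = Re w * sqrt (1 + q²)).
    { apply Rsqr_inj. apply Cmod_ge_0. apply Rmult_le_pos. lra. apply sqrt_pos.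
      rewrite Rsqr_mult, Rsqr_sqrt.
      2: { assert (X := Rle_0_sqr q). lra. }
      unfold Rsqr at 1. rewrite <- normsq_Cmod. unfold normsq, q, Rsqr. field. lra. }
    assert (0 < sqrt (1 + q²)) by (apply sqrt_lt_R0; assert (X := Rle_0_sqr q); lra).
    rewrite Hq. field. split; lra. }
  unfold Carg. rewrite E. assert (B := atan_bound q). assert (P := PI_RGT_0).
  destruct (Rle_dec 0 (Im w)) as [H|H].
  - apply acos_cos. split; [|lra].
    destruct (Rle_lt_or_eq_dec 0 q) as [Hq|Hq].
    + unfold q. apply Rmult_le_pos; auto. left. now apply Rinv_0_lt_compat.
    + rewrite <- atan_0. left. now apply atan_increasing.
    + rewrite <- Hq, atan_0. lra.
  - rewrite <- cos_neg, acos_cos. ring.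
    assert (q < 0).
    { unfold q. assert (0 < / Re w) by now apply Rinv_0_lt_compat. unfold Rdiv. nra. }
    assert (atan q < 0). { rewrite <- atan_0. now apply atan_increasing. } lra.
Qed.

(** The two functions of [s] are the real and the imaginary part of
    [log ((1 + s zeta) / (1 - s zeta))] with [zeta = (x, y)], whose derivative is
    [2 zeta / (1 - s^2 zeta^2)]. *)
Lemma strip_path_derive x y s : 0 <= s <= 1 -> x * x + y * y < 1 ->
  is_derive (fun s => / 2 * (ln (1 + 2 * s * x + s * s * (x * x + y * y))
                             - ln (1 - 2 * s * x + s * s * (x * x + y * y)))) s
    (Re (2 * (x, y) / (1 - (s * (x, y)) * (s * (x, y))))%C) /\
  is_derive (fun s => atan (2 * s * y / (1 - s * s * (x * x + y * y)))) s
    (Im (2 * (x, y) / (1 - (s * (x, y)) * (s * (x, y))))%C).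
Proof.
  intros Hs Hxy. set (n := x * x + y * y) in *.
  assert (Hss : 0 <= s * s <= 1) by nra.
  assert (Hn0 : 0 <= n) by (unfold n; nra).
  assert (Hd : 0 < 1 - s * s * n) by nra.
  assert (Hxx : (s * x) * (s * x) <= s * s * n) by (unfold n; nra).
  assert (Hp : 0 < 1 + 2 * s * x + s * s * n) by nra.
  assert (Hm : 0 < 1 - 2 * s * x + s * s * n) by nra.
  (* the denominators agree since [|1 - s^2 zeta^2|^2 = |1 - s zeta|^2 |1 + s zeta|^2] *)
  assert (EN : (1 - (s * s * (x * x - y * y))) ^ 2 + (2 * (s * s * (x * y))) ^ 2 
     = (1 + 2 * s * x + s * s * n) * (1 - 2 * s * x + s * s * n)) by (unfold n; ring).
  assert (EN2 : (1 - s * s * n) ^ 2 + (2 * s * y) ^ 2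
     = (1 + 2 * s * x + s * s * n) * (1 - 2 * s * x + s * s * n)) by (unfold n; ring).
  assert (EC : (2 * (x, y) / (1 - (s * (x, y)) * (s * (x, y))))%C =
     ((2 * x * (1 - s * s * n)) / ((1 + 2 * s * x + s * s * n) * (1 - 2 * s * x + s * s * n)),
      (2 * y * (1 + s * s * n)) / ((1 + 2 * s * x + s * s * n) * (1 - 2 * s * x + s * s * n)))).
  { rewrite <- EN. assert (HN : (1 - (s * s * (x * x - y * y))) ^ 2 + (2 * (s * s * (x * y))) ^ 2 <> 0).
    { rewrite EN. apply Rgt_not_eq. now apply Rmult_lt_0_compat. }
    unfold Cdiv, Cinv, Cmult, Cminus, Cplus, Copp, RtoC. simpl.
    f_equal; unfold n; field; intros H; apply HN; rewrite <- H; ring. }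
  rewrite EC. split; simpl.
  -  auto_derive. repeat split; lra.
    replace (1 + - (2 * s * x) + s * s * n) with (1 - 2 * s * x + s * s * n) by ring.
    field. split; lra.
  - auto_derive. lra.
    unfold Rsqr. rewrite <- EN2. replace (1 + - (s * s * n)) with (1 - s * s * n) by ring.
    assert ((1 - s * s * n) ^ 2 + (2 * s * y) ^ 2 <> 0).
    { rewrite EN2. apply Rgt_not_eq. now apply Rmult_lt_0_compat. }
    field. repeat split; try lra.
Qed.

(** The factors 1 are the value at [s = 1] of the parameter in
    [strip_path_derive]. *)
Lemma Clog_quotient z : Cmod z < 1 ->
  Clog ((1 + z) / (1 - z))%C =
  (/ 2 * (ln (1 + 2 * 1 * Re z + 1 * 1 * (Re z * Re z + Im z * Im z))
          - ln (1 - 2 * 1 * Re z + 1 * 1 * (Re z * Re z + Im z * Im z))),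
   atan (2 * 1 * Im z / (1 - 1 * 1 * (Re z * Re z + Im z * Im z)))).
Proof.
  intros Hz. assert (Hz0 := Cmod_ge_0 z).
  assert (Hn : normsq z < 1) by (rewrite normsq_Cmod; nra).
  assert (NZ : forall w : C, 0 < normsq w -> w <> 0%C).
  { intros w Hw E. rewrite E in Hw. unfold normsq in Hw. simpl in Hw. lra. }
  destruct z as [x y]. unfold normsq in Hn. simpl in Hn |- *. set (n := x * x + y * y) in *.
  assert (Hp : 0 < 1 + 2 * 1 * x + 1 * 1 * n) by (unfold n in *; nra).
  assert (Hm : 0 < 1 - 2 * 1 * x + 1 * 1 * n) by (unfold n in *; nra).
  assert (Ep : normsq (1 + (x, y))%C = 1 + 2 * 1 * x + 1 * 1 * n) by (unfold normsq, n; simpl; ring).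
  assert (Em : normsq (1 - (x, y))%C = 1 - 2 * 1 * x + 1 * 1 * n) by (unfold normsq, n; simpl; ring).
  assert (Ln : forall w, 0 < normsq w -> ln (Cmod w) = / 2 * ln (normsq w)).
  { intros w Hw. assert (0 < Cmod w) by (apply Cmod_gt_0; auto).
    rewrite normsq_Cmod, ln_mult by auto. field. }
  assert (Np : (1 + (x, y))%C <> 0%C) by (apply NZ; lra).
  assert (Nm : (1 - (x, y))%C <> 0%C) by (apply NZ; lra).
  assert (Hre : Re ((1 + (x, y)) / (1 - (x, y)))%C = (1 - n) / (1 - 2 * 1 * x + 1 * 1 * n)).
  { rewrite <- Em. unfold Cdiv, Cinv, Cmult, Cminus, Cplus, Copp, RtoC, normsq, n; simpl.
    field. rewrite <- Em in Hm. unfold normsq in Hm. simpl in Hm. apply Rgt_not_eq; lra. }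
  assert (Him : Im ((1 + (x, y)) / (1 - (x, y)))%C = 2 * y / (1 - 2 * 1 * x + 1 * 1 * n)).
  { rewrite <- Em. unfold Cdiv, Cinv, Cmult, Cminus, Cplus, Copp, RtoC, normsq, n; simpl.
    field. rewrite <- Em in Hm. unfold normsq in Hm. simpl in Hm. apply Rgt_not_eq; lra. }
  unfold Clog. rewrite Carg_right_half_plane.
  2: { rewrite Hre. apply Rdiv_lt_0_compat; lra. }
  rewrite Cmod_div by auto. unfold Rdiv at 1. rewrite ln_mult, ln_Rinv, !Ln, Ep, Em.
  - f_equal. ring. rewrite Hre, Him. f_equal. field. split; lra.
  - lra.
  - lra.
  - now apply Cmod_gt_0.
  - now apply Cmod_gt_0.
  - apply Rinv_0_lt_compat. now apply Cmod_gt_0.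
Qed.

(** Along each radius, [2 l f] and the logarithm in the strip map have the same
    derivative and both vanish at the centre. *)
Theorem strip_of_derivative a l :
  summable a -> a 0%nat = 0%C -> Cmod l = 1 ->
  (forall z, Cmod z < 1 -> psum (derived a) z * (1 - l * l * z * z) = 1)%C ->
  is_rotation_of parallel_strip (psum a).
Proof.
  intros Ha H0 Hl Hd. exists l. split; auto. intros z Hz. red in Hz.
  assert (Hz0 := Cmod_ge_0 z).
  set (ze := (l * z)%C). assert (Hze : Cmod ze < 1) by (unfold ze; rewrite Cmod_mult, Hl; lra).
  assert (Hin : forall s, 0 <= s <= 1 -> Cmod (0 + s * z)%C < 1).
  { intros s Hs. rewrite Cmod_path by lra. nra. }
  assert (Hn : Re ze * Re ze + Im ze * Im ze < 1).
  { change (normsq ze < 1). rewrite normsq_Cmod. assert (X := Cmod_ge_0 ze). nra. }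
  assert (Hzp : (Re ze, Im ze) = ze) by (now destruct ze).
  assert (D : forall s, 0 <= s <= 1 ->
     (2 * l * (z * psum (derived a) (0 + s * z)))%C = (2 * (Re ze, Im ze) / (1 - (s * (Re ze, Im ze)) * (s * (Re ze, Im ze))))%C).
  { intros s Hs. rewrite Hzp. specialize (Hd _ (Hin s Hs)).
    set (v := psum (derived a) (0 + s * z)%C) in *.
    replace (1 - s * ze * (s * ze))%C with (1 - l * l * (0 + s * z) * (0 + s * z))%C by (unfold ze; ring).
    set (w := (1 - l * l * (0 + s * z) * (0 + s * z))%C) in *.
    assert (Nw : w <> 0%C).
    { intros E. rewrite E in Hd. replace (v * 0)%C with (RtoC 0) in Hd by ring. apply RtoC_inj in Hd. lra. }
    transitivity (2 * l * z * (v * w) / w)%C. field; auto. rewrite Hd. unfold ze. field; auto. }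
  set (L := fun s : R => / 2 * (ln (1 + 2 * s * Re ze + s * s * (Re ze * Re ze + Im ze * Im ze))
                             - ln (1 - 2 * s * Re ze + s * s * (Re ze * Re ze + Im ze * Im ze)))).
  set (A := fun s : R => atan (2 * s * Im ze / (1 - s * s * (Re ze * Re ze + Im ze * Im ze)))).
  assert (ER : Re (2 * l * psum a (0 + 1 * z))%C - L 1 = Re (2 * l * psum a (0 + 0 * z))%C - L 0).
  { apply (constant_of_derive (fun s : R => Re (2 * l * psum a (0 + s * z))%C - L s)). lra.
    intros s Hs. destruct (strip_path_derive (Re ze) (Im ze) s Hs Hn) as [DL _].
    assert (D1 := psum_path_derive a (2 * l)%C 0%C z s Ha (Hin s Hs)).
    rewrite <- (D s Hs) in DL.
    assert (D2 := is_derive_minus _ _ _ _ _ D1 DL).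
    evar_last. exact D2. apply Rminus_diag. }
  assert (EI : Re (- Ci * (2 * l) * psum a (0 + 1 * z))%C - A 1 = Re (- Ci * (2 * l) * psum a (0 + 0 * z))%C - A 0).
  { apply (constant_of_derive (fun s : R => Re (- Ci * (2 * l) * psum a (0 + s * z))%C - A s)). lra.
    intros s Hs. destruct (strip_path_derive (Re ze) (Im ze) s Hs Hn) as [_ DA].
    assert (D1 := psum_path_derive a (- Ci * (2 * l))%C 0%C z s Ha (Hin s Hs)).
    rewrite <- (D s Hs) in DA.
    assert (D2 := is_derive_minus _ _ _ _ _ D1 DA).
    evar_last. exact D2.
    replace (- Ci * (2 * l) * (z * psum (derived a) (0 + s * z)))%C
      with (- Ci * (2 * l * (z * psum (derived a) (0 + s * z))))%C by ring.
    generalize (2 * l * (z * psum (derived a) (0 + s * z)))%C. intros [p q].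
    unfold minus, plus, opp. simpl. ring. }
  replace (0 + 1 * z)%C with z in ER, EI by ring. replace (0 + 0 * z)%C with (RtoC 0) in ER, EI by ring.
  rewrite psum_0, H0 in ER, EI by auto.
  replace (2 * l * 0)%C with (RtoC 0) in ER by ring. replace (- Ci * (2 * l) * 0)%C with (RtoC 0) in EI by ring.
  assert (L0 : L 0 = 0).
  { unfold L. replace (1 + 2 * 0 * Re ze + 0 * 0 * (Re ze * Re ze + Im ze * Im ze)) with 1 by ring.
    replace (1 - 2 * 0 * Re ze + 0 * 0 * (Re ze * Re ze + Im ze * Im ze)) with 1 by ring.
    rewrite ln_1. ring. }
  assert (A0 : A 0 = 0).
  { unfold A. replace (2 * 0 * Im ze / (1 - 0 * 0 * (Re ze * Re ze + Im ze * Im ze))) with 0 by (field).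
    apply atan_0. }
  rewrite L0 in ER. rewrite A0 in EI.
  unfold parallel_strip. rewrite Clog_quotient by auto. fold (L 1). fold (A 1).
  assert (EF : (L 1, A 1) = (2 * l * psum a z)%C).
  { clear - ER EI. clearbody L A. revert ER EI. generalize (psum a z). intros [p q].
    destruct l as [l1 l2]. unfold Cmult, RtoC. simpl. intros ER EI. f_equal; lra. }
  rewrite EF. transitivity ((Cconj l * l) * psum a z)%C.
  - replace (Cconj l * l)%C with (RtoC 1). ring.
    replace (Cconj l * l)%C with (l * Cconj l)%C by ring. rewrite <- Cmod2_conj, Hl. simpl. f_equal; ring.
  - rewrite RtoC_div by lra. field.
Qed.

(** * The boundary regularity theorem *)

Lemma sum_n_csum (a : nat -> C) (z : C) n :
  sum_n (fun k => @scal C_AbsRing C_NormedModule (pow_n (K := C_AbsRing) z k) (a k)) n = csum a z (S n).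
Proof.
  assert (P : forall k, pow_n (K := C_AbsRing) z k = (z ^ k)%C).
  { induction k; simpl; auto; now rewrite IHk. }
  induction n.
  - rewrite sum_O, P. simpl. change (1 * a 0%nat = 0 + a 0%nat * 1)%C. ring.
  - rewrite sum_Sn, IHn, P. 
    change (csum a z (S n) + z ^ (S n) * a (S n) = csum a z (S n) + a (S n) * z ^ (S n))%C. ring.
Qed.

Lemma is_pseries_clim (a : nat -> C) (z l : C) :
  is_pseries (K := C_AbsRing) (V := C_NormedModule) a z l -> clim (csum a z) l.
Proof.
  intros H. apply clim_incr_1. unfold clim. apply is_lim_seq_spec. intros e.
  assert (He2 : 0 < e / 2) by (assert (X := cond_pos e); lra).
  destruct (H (fun w => ball l (mkposreal _ He2) w)) as [N HN].
  { exists (mkposreal _ He2). auto. }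
  exists N. intros n Hn. destruct (HN n Hn) as [H1 H2].
  rewrite sum_n_csum in H1, H2.
  rewrite Rminus_0_r, Rabs_pos_eq by apply Cmod_ge_0.
  eapply Rle_lt_trans. apply Cmod_le_re_im.
  change (Rabs (fst (csum a z (S n)) - fst l) < e / 2) in H1.
  change (Rabs (snd (csum a z (S n)) - snd l) < e / 2) in H2.
  change (Rabs (fst (csum a z (S n)) - fst l) + Rabs (snd (csum a z (S n)) - snd l) < e). lra.
Qed.

(** Passing from [f] to the sum of its series changes nothing inside the disk, and
    there the theory of [psum] applies. *)
Lemma class_C_psum f a :
  class_C f a ->
  summable a /\ (forall z, Cmod z < 1 -> psum a z = f z) /\
  injective_on unit_disk (psum a) /\ convex_set (image_of unit_disk (psum a)).
Proof.
  intros [(_ & Hinj & Hps & _) Hconv].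
  assert (Hs : summable a).
  { apply clim_summable with f. intros z Hz. apply is_pseries_clim. now apply Hps. }
  assert (E : forall z, Cmod z < 1 -> psum a z = f z).
  { intros z Hz. apply psum_unique; auto. apply is_pseries_clim. now apply Hps. }
  split; [|split; [|split]]; auto.
  - intros z w Hz Hw. rewrite !E by auto. auto.
  - assert (I : forall v, image_of unit_disk (psum a) v <-> image_of unit_disk f v).
    { intros v. split; intros (z & Hz & Ez); exists z; split; auto.
      now rewrite <- E. now rewrite E. }
    intros u v s Hu Hv Hs'. apply I. apply Hconv; auto; now apply I.
Qed.

Lemma Cmod_one_minus_ge (z x : C) : 1 - Cmod z * Cmod z * Cmod x <= Cmod (1 - z * z * x)%C.
Proof.
  assert (T := Cmod_triangle (1 - z * z * x)%C (z * z * x)%C).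
  replace (1 - z * z * x + z * z * x)%C with (RtoC 1) in T by ring.
  rewrite Cmod_1, !Cmod_mult in T. lra.
Qed.

Theorem theorem6 :
  forall (f : C -> C) (a : nat -> C),
    class_C f a ->
    a 2%nat = 0%C ->
    ~ is_rotation_of parallel_strip f ->
    boundary_in_Lambda f
      ((1 - 3 * Cmod (a 3%nat)) / (3 * (1 + Cmod (a 3%nat)))).
Proof.
  intros f a Hf H2 Hnot.
  destruct (class_C_psum f a Hf) as (Ha & Ef & Hinj & Hconv).
  destruct Hf as [(_ & _ & _ & H0 & H1) _].
  assert (Hd := derived_summable a Ha).
  assert (Hd0 : derived a 0%nat = 1%C) by (unfold derived; rewrite H1; simpl; ring).
  destruct (convex_schwarz_function a Ha Hinj Hconv H1 H2) as (psi & Tpsi & Bpsi & Psi0 & Hode).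
  assert (Pick := schwarz_pick psi Tpsi Bpsi).
  set (al := Cmod (psi 0%C)) in *.
  assert (Eal : al = 3 * Cmod (a 3%nat)).
  { unfold al. rewrite Psi0, Cmod_mult, Cmod_R, Rabs_pos_eq by lra. reflexivity. }
  assert (Hal0 : 0 <= al) by apply Cmod_ge_0.
  assert (Hal1 : al <= 1) by (apply Bpsi; rewrite Cmod_0; lra).
  assert (Hal : al < 1).
  { destruct (Rle_lt_or_eq_dec _ _ Hal1) as [H|H]; auto. exfalso. apply Hnot.
    assert (Econj : (Cconj (psi 0) * psi 0 = 1)%C).
    { replace (Cconj (psi 0) * psi 0)%C with (psi 0 * Cconj (psi 0))%C by ring.
      rewrite <- Cmod2_conj. fold al. rewrite H. simpl. f_equal; ring. }
    assert (Const : forall z, Cmod z < 1 -> psi z = psi 0%C).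
    { intros z Hz. specialize (Pick z Hz).
      replace (1 - Cconj (psi 0) * psi z)%C with (- (Cconj (psi 0) * (psi z - psi 0)))%C in Pick.
      2: { rewrite <- Econj. ring. }
      rewrite Cmod_opp, Cmod_mult, Cmod_conj in Pick. fold al in Pick. rewrite H in Pick.
      assert (X := Cmod_ge_0 (psi z - psi 0)%C).
      assert (Z : Cmod (psi z - psi 0)%C = 0) by nra.
      apply Cmod_eq_0 in Z. replace (psi z) with (psi z - psi 0 + psi 0)%C by ring. rewrite Z. ring. }
    destruct (unimodular_sqrt (psi 0%C) H) as (l & Hl & Hll).
    destruct (strip_of_derivative a l Ha H0 Hl) as (m & Hm & Em).
    - rewrite Hll. intros z Hz. apply derivative_of_extremal; auto.
      intros w Hw. rewrite <- (Const w Hw) at 1 2. now apply Hode.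
    - exists m. split; auto. intros z Hz. rewrite <- Ef by auto. now apply Em. }
  set (t := (1 - al) / (3 + al)).
  assert (Et : (1 - 3 * Cmod (a 3%nat)) / (3 * (1 + Cmod (a 3%nat))) = t).
  { unfold t. rewrite Eal. f_equal. ring. }
  assert (Ht : 0 < t <= 1).
  { unfold t. split. apply Rdiv_lt_0_compat; lra.
    apply (Rmult_le_reg_r (3 + al)). lra. unfold Rdiv. rewrite Rmult_assoc, Rinv_l; lra. }
  assert (Growth : forall z, Cmod z < 1 -> Cmod (psum (derived a) z) <= Rpower (1 - Cmod z) (t - 1)).
  { intros z Hz.
    assert (G := growth_of_log_derivative (derived a) (1 - t) Hd ltac:(lra)).
    rewrite Hd0, Cmod_1 in G.
    replace (t - 1) with (- (1 - t)) by ring. rewrite <- (Rmult_1_l (Rpower _ _)). apply G; auto.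
    clear z Hz. intros z Hz. assert (Hr := Cmod_ge_0 z). set (r := Cmod z) in *.
    set (fp := psum (derived a) z). set (fpp := psum (derived (derived a)) z).
    assert (Hx1 := Bpsi z Hz). assert (Hx0 := Cmod_ge_0 (psi z)).
    assert (Hx : Cmod (psi z) * (1 + al * r) <= r + al).
    { apply schwarz_pick_growth; auto. }
    assert (Hrs := pre_schwarzian_rate (Cmod (psi z)) r al ltac:(lra) ltac:(lra) Hx0 Hx).
    assert (Emod : Cmod fpp * Cmod (1 - z * z * psi z)%C = 2 * r * Cmod (psi z) * Cmod fp).
    { assert (E := f_equal Cmod (Hode z Hz)). fold fpp fp in E.
      rewrite !Cmod_mult in E. rewrite E, Cmod_R, Rabs_pos_eq by lra. reflexivity. }
    assert (Hlow := Cmod_one_minus_ge z (psi z)). fold r in Hlow.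
    set (x := Cmod (psi z)) in *. set (den := 1 - r * r * x) in *.
    assert (Hden : 0 < den) by (unfold den; nra).
    assert (Hfp := Cmod_ge_0 fp). assert (Hfpp := Cmod_ge_0 fpp).
    assert (E1t : 1 - t = 2 * (1 + al) / (3 + al)) by (unfold t; field; lra).
    rewrite E1t.
    apply (Rmult_le_reg_r (den * (3 + al))). apply Rmult_lt_0_compat; lra.
    apply Rle_trans with (2 * r * x * Cmod fp * ((1 - r) * (3 + al))).
    - replace (Cmod fpp * (1 - r) * (den * (3 + al))) with (Cmod fpp * den * ((1 - r) * (3 + al))) by ring.
      apply Rmult_le_compat_r. apply Rmult_le_pos; lra. rewrite <- Emod.
      now apply Rmult_le_compat_l.
    - replace (2 * (1 + al) / (3 + al) * Cmod fp * (den * (3 + al))) with (2 * Cmod fp * ((1 + al) * den))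
        by (field; lra).
      replace (2 * r * x * Cmod fp * ((1 - r) * (3 + al))) with (2 * Cmod fp * (r * x * (1 - r) * (3 + al))) by ring.
      apply Rmult_le_compat_l; lra. }
  assert (HL := hardy_littlewood a t Ha Ht Growth).
  set (K := 2 / t + 2) in HL.
  assert (HK : 0 < K).
  { assert (0 < 2 / t) by (apply Rdiv_lt_0_compat; lra). unfold K; lra. }
  destruct (holder_extension (psum a) K t HK ltac:(lra) HL) as (F & EF & HF).
  rewrite Et. exists F. split; [|split].
  - apply holder_continuous_on with K t; auto. lra.
  - intros z Hz. rewrite EF by auto. now apply Ef.
  - apply holder_boundary with K; auto.
Qed.
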